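(* Let $k,m,n$ be positive integers. (1) If $\frac mn\in(0,\frac12]\cup(1,\infty)$ and $(m,n)\notin\{(3,2),(5,2),(7,2),\ldots\}$, then $\mathcal{D}_{m,n}$ contains some right neighborhood $[0,c_{m,n}]$ of $0$ (with $c_{m,n}>0$). (2) If $m\mid n$ or $n\mid m$, and $(m,n)\ne(1,1)$, then $\mathcal{D}_{m,n}=[0,1]$. (3) Moreover, $\mathcal{D}_{m,n}\subseteq\mathcal{D}_{km,kn}$.
   Context: Everything is with respect to maximum norms $\|\cdot\|_\infty$ on $\mathbb{R}^n$ and $\mathbb{R}^m$. For $\Omega\in\mathbb{R}^{m\times n}$ and $t\ge1$ let $$\psi_\Omega^{m\times n}(t)=\min\{\|\Omega\hat{\boldsymbol b}+\tilde{\boldsymbol b}\|_\infty:\hat{\boldsymbol b}\in\mathbb{Z}^n,\ \tilde{\boldsymbol b}\in\mathbb{Z}^m,\ 1\le\|\hat{\boldsymbol b}\|_\infty\le t\},$$ and $\Theta^{m\times n}(\Omega)=\limsup_{t\to\infty}t^{n/m}\psi_\Omega^{m\times n}(t)$. The Dirichlet spectrum is $\mathcal{D}_{m,n}=\{\Theta^{m\times n}(\Omega):\Omega\in\mathbb{R}^{m\times n}\}\subseteq[0,1]$. *)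

(* Defs.v *)
From HB Require Import structures.
From mathcomp Require Import all_boot all_order all_algebra.
From mathcomp Require Import all_classical all_reals all_analysis.

Set Implicit Arguments.
Unset Strict Implicit.
Unset Printing Implicit Defensive.
Import Order.TTheory GRing.Theory Num.Theory.
Import numFieldNormedType.Exports.
Local Open Scope classical_set_scope.
Local Open Scope ring_scope.

Definition intvec (R : realType) (n : nat) (b : 'cV[int]_n) : 'cV[R]_n :=
  map_mx intr b.

(* [`|v|] for [v : 'cV[R]_n] is the library norm on matrices, i.e. the maximum
   norm (see [mx_normrE]). *)
Definition approx_values (R : realType) (m n : nat) (Omega : 'M[R]_(m, n))
    (t : R) : set R :=
  [set x | exists (b : 'cV[int]_n) (c : 'cV[int]_m),
     1 <= `|intvec R b| <= t /\ x = `|Omega *m intvec R b + intvec R c| ].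

(* For [0 < n] and [1 <= t] this infimum is a minimum: see [psi_is_min]. *)
Definition psi (R : realType) (m n : nat) (Omega : 'M[R]_(m, n)) (t : R) : R :=
  inf (approx_values Omega t).

Definition Theta (R : realType) (m n : nat) (Omega : 'M[R]_(m, n)) : \bar R :=
  limf_esup (fun t : R => (t `^ (n%:R / m%:R) * psi Omega t)%:E)
            (pinfty_nbhs R).

(* A limsup is a priori an extended real, so the spectrum is a set of extended
   reals; no value of [Theta] is truncated or discarded. *)
Definition Dirichlet_spectrum (R : realType) (m n : nat) : set (\bar R) :=
  range (@Theta R m n).

Arguments Dirichlet_spectrum : clear implicits.

Lemma normcV_le (R : realType) (n : nat) (v : 'cV[R]_n) (i : 'I_n) :
  `|v i ord0| <= `|v|.
Proof.
rewrite [leRHS]/Num.Def.normr /= mx_normrE.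
by apply/bigmax_geP; right => /=; exists (i, ord0).
Qed.

Lemma normcV_leP (R : realType) (n : nat) (v : 'cV[R]_n) (r : R) : 0 <= r ->
  (forall i, `|v i ord0| <= r) -> `|v| <= r.
Proof.
move=> r0 h; rewrite [leLHS]/Num.Def.normr /= mx_normrE.
by apply: bigmax_le => // -[i j] _ /=; rewrite (ord1 j).
Qed.

Lemma approx_values_min (R : realType) (m n : nat) (Omega : 'M[R]_(m, n))
    (t : R) : (0 < n)%N -> 1 <= t ->
  exists2 x, approx_values Omega t x & lbound (approx_values Omega t) x.
Proof.
move=> n0 t1; have t0 : 0 <= t by exact: le_trans t1.
pose w (b : 'cV[int]_n) (c : 'cV[int]_m) :=
  `|Omega *m intvec R b + intvec R c|.
pose b1 : 'cV[int]_n := const_mx 1; pose v0 := w b1 0.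
have b1n : 1 <= `|intvec R b1| <= t.
  apply/andP; split.
    by have := normcV_le (intvec R b1) (Ordinal n0); rewrite !mxE normr1.
  by apply: normcV_leP => // i; rewrite !mxE normr1.
pose C := \sum_i \sum_j `|Omega i j| * t.
have C0 : 0 <= C by do 2!apply: sumr_ge0 => ? _; rewrite mulr_ge0.
have v00 : 0 <= v0 by exact: normr_ge0.
pose N := (Num.truncn (t + v0 + C)).+1.
have NP : t + v0 + C < N%:R by rewrite truncnS_gt.
pose K := (N + N)%N.
pose dec k (a : 'cV['I_K.+1]_k) : 'cV[int]_k :=
  map_mx (fun i : 'I_K.+1 => (i : nat)%:Z - N%:Z) a.
have decS k (b : 'cV[int]_k) :
    (forall i, `|(b i ord0)%:~R : R| <= N%:R) -> exists a, dec k a = b.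
  move=> bN; exists (\col_i inord `|(b i ord0 + N%:Z)%R|%N).
  apply/colP => i; rewrite !mxE.
  have := bN i; rewrite -intr_norm -[N%:R]/((N%:Z)%:~R) ler_int ler_norml.
  move=> /andP[h1 h2].
  have h3 : 0 <= b i ord0 + N%:Z by rewrite -lerBlDr sub0r.
  rewrite inordK; first by rewrite gez0_abs// addrK.
  by rewrite ltnS -lez_nat gez0_abs// PoszD lerD2r.
pose P (p : 'cV['I_K.+1]_n * 'cV['I_K.+1]_m) :=
  1 <= `|intvec R (dec n p.1)| <= t.
pose F (p : 'cV['I_K.+1]_n * 'cV['I_K.+1]_m) := w (dec n p.1) (dec m p.2).
have dom b c : 1 <= `|intvec R b| <= t -> w b c <= v0 ->
    exists2 p, P p & F p = w b c.
  move=> bt wv; have bi j : `|(b j ord0)%:~R : R| <= t.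
    have := normcV_le (intvec R b) j; rewrite mxE => /le_trans; apply.
    by case/andP: bt.
  have [|a ab] := decS n b.
    move=> i; apply: le_trans (bi i) _; apply: le_trans (ltW NP).
    by rewrite -addrA lerDl addr_ge0.
  have [|a' ac] := decS m c.
    move=> i; apply: le_trans (ltW NP).
    have -> : (c i ord0)%:~R =
       (Omega *m intvec R b + intvec R c) i ord0 - (Omega *m intvec R b) i ord0.
      by rewrite !mxE addrAC subrr add0r.
    apply: le_trans (ler_normB _ _) _; rewrite -addrA.
    apply: le_trans (_ : v0 + C <= _); last by rewrite lerDr.
    apply: lerD; first exact: le_trans (normcV_le _ _) wv.
    rewrite mxE /C (bigD1 i)//=; apply: ler_wpDr.
      by do 2!apply: sumr_ge0 => ? _; rewrite mulr_ge0.
    apply: le_trans (ler_norm_sum _ _ _) _; apply: ler_sum => j _.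
    by rewrite normrM mxE ler_wpM2l.
  by exists (a, a'); rewrite /P /F /= ?ab ?ac.
have [p0 Pp0 Fp0] := dom b1 0 b1n (lexx _).
case: (Order.TotalTheory.arg_minP F Pp0) => p Pp pmin.
exists (F p); first by exists (dec n p.1), (dec m p.2).
move=> _ [b [c [bt ->]]]; rewrite -/(w b c).
have [wv|/ltW wv] := leP (w b c) v0.
  by have [q Pq <-] := dom b c bt wv; exact: pmin.
by apply: le_trans wv; rewrite /v0 -Fp0; exact: pmin.
Qed.

Lemma psi_is_min (R : realType) (m n : nat) (Omega : 'M[R]_(m, n)) (t : R) :
  (0 < n)%N -> 1 <= t ->
  approx_values Omega t (psi Omega t) /\
  lbound (approx_values Omega t) (psi Omega t).
Proof.
move=> n0 t1; have [x Ax lx] := approx_values_min Omega n0 t1.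
suff -> : psi Omega t = x by [].
apply/eqP; rewrite eq_le; apply/andP; split.
  by apply: ge_inf => //; exists x.
by apply: lb_le_inf => //; exists x.
Qed.

(* Main.v *)
Require Import Defs.
From mathcomp Require Import all_boot all_order all_algebra.
From mathcomp Require Import all_classical all_reals all_analysis.
From mathcomp Require Import ring lra zify.

Import Order.TTheory GRing.Theory Num.Theory.
Import numFieldNormedType.Exports.
Local Open Scope classical_set_scope.
Local Open Scope ring_scope.

(** Except for (m, n) = (1, 1), every value in [[0, 1]] is the [Theta] of some
    matrix.  Dirichlet's pigeonhole argument bounds [Theta] by 1, so the point
    is to construct a matrix with [Theta] equal to a given [lam].

    Put [L = lam ^+ m] and [v k = k.+1 ^+ n * psi Om k ^+ m].  Since [psi Om] is
    constant between consecutive integers, [Theta Om = lam] as soon as the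
    sequence [v] has limit superior [L] ([Theta_le], [Theta_ge]).  Each [v k]
    depends continuously on [Om], so [Om] can be built as a limit of matrices
    [Om_s], together with times [T_s], such that the maximum of [v] over
    [T_s <= k < T_(s+1)] is close to [L] for [Om_(s+1)]; later corrections are so
    small that they do not spoil this ([exists_limit_of_stages]).

    With at least two columns, a stage starts from a matrix with dyadic entries
    for which [psi] vanishes from time [T] on.  Add to it the matrix with
    entries [D ^ (i * m) / D ^ ((j + 1) * n)], [D] a large power of two
    (integral entries may be dropped).  For integers [|b_i| < D ^ m] the numbers
    [b_i] are read as the blocks of digits of [sum_i b_i * D ^ (i * m)]; row [j]
    detects the digits of positions
    [j * n, ..., (j + 1) * n - 1] in base [D], so some row of the product is at
    distance at least [D ^ - n] from the integers unless [b = 0]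
    ([critical_psi_ge]).  Hence [v k >= 1] at [k = D ^ m - 1].  If the same
    perturbation is applied to all columns but the first, then [v] is tiny up to
    [D ^ m], because the first column is still rational with a small
    denominator.  Moving the first column from one position to the other in tiny
    steps, the maximum of [v] crosses [L] somewhere.  The last column is the
    same along the whole path and has denominator [D ^ m], so [psi] vanishes
    from [D ^ m] on and the next stage can start ([dyadic_stage]).

    With one column and m >= 2 there is no second column to play this role.  The
    zero vector has [Theta] equal to 0; for [lam > 0] the stage is explicit: to a
    vector with denominator [T] add
    [1 / N, 1 / N ^ 2, ..., 1 / N ^ (m - 1), 1 / (c * N ^ (m - 1))], where [N] is
    a high power of [T] and [c] is the least integer with
    [(N / c) ^ (m - 1) <= L].  The best approximations are [T], [N] and
    [N ^ (m - 1)], and the last one, which leaves the distance [1 / c], is not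
    improved before [c * N ^ (m - 1)] ([simultaneous_stage]).

    Finally, a block diagonal matrix made of [k] copies of [Om] has the same
    [psi] as [Om], since a nonzero vector has a nonzero block; this is the
    inclusion of the spectrum for (m, n) in that for (k m, k n). *)

Set Implicit Arguments.
Unset Strict Implicit.
Unset Printing Implicit Defensive.

(** * Basic properties of psi *)

Lemma intvec_norm_ge1 (R : realType) (n : nat) (b : 'cV[int]_n) (i : 'I_n) :
  b i ord0 != 0 -> 1 <= `|intvec R b|.
Proof.
move=> bi; apply: le_trans (normcV_le (intvec R b) i).
by rewrite mxE -intr_norm -[1]/(1%:~R) ler_int -gtz0_ge1 normr_gt0.
Qed.

Lemma intvec_neq0 (R : realType) (n : nat) (b : 'cV[int]_n) :
  1 <= `|intvec R b| -> exists i, b i ord0 != 0.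
Proof.
move=> b1; apply/existsP; apply: contraTT b1 => /existsPn b0.
rewrite -ltNge; apply: le_lt_trans ltr01.
by apply: normcV_leP => // i; rewrite mxE (eqP (negPn (b0 i))) normr0.
Qed.

Lemma intvec_entry_le (R : realType) (n k : nat) (b : 'cV[int]_n) (i : 'I_n) :
  `|intvec R b| <= k%:R -> `|b i ord0| <= k%:Z.
Proof.
move=> /(le_trans (normcV_le (intvec R b) i)).
by rewrite mxE -intr_norm -[k%:R]/((k%:Z)%:~R) ler_int.
Qed.

Lemma psi_ge0 (R : realType) (m n : nat) (Om : 'M[R]_(m, n)) (t : R) :
  0 <= psi Om t.
Proof.
rewrite /psi; have [->|/set0P A0] := eqVneq (approx_values Om t) set0.
  by rewrite inf0.
by apply: lb_le_inf => // _ [b [c [_ ->]]]; exact: normr_ge0.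
Qed.

Lemma psi_le (R : realType) (m n : nat) (Om : 'M[R]_(m, n)) (t : R) b c :
  1 <= `|intvec R b| <= t -> psi Om t <= `|Om *m intvec R b + intvec R c|.
Proof.
move=> bt; apply: ge_inf; last by exists b, c.
by exists 0 => _ [b' [c' [_ ->]]]; exact: normr_ge0.
Qed.

Lemma psi_ge (R : realType) (m n : nat) (Om : 'M[R]_(m, n)) (t r : R) :
  (0 < n)%N -> 1 <= t ->
  (forall b c, 1 <= `|intvec R b| <= t ->
     r <= `|Om *m intvec R b + intvec R c|) ->
  r <= psi Om t.
Proof.
move=> n0 t1 h; have [[b [c [bt ->]]] _] := psi_is_min Om n0 t1.
exact: h.
Qed.

Lemma psi_anti (R : realType) (m n : nat) (Om : 'M[R]_(m, n)) (s t : R) :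
  (0 < n)%N -> 1 <= s -> s <= t -> psi Om t <= psi Om s.
Proof.
move=> n0 s1 st; apply: psi_ge => // b c /andP[b1 bs].
by apply: psi_le; rewrite b1 (le_trans bs).
Qed.

Lemma const1_norm (R : realType) (n : nat) (t : R) : (0 < n)%N -> 1 <= t ->
  1 <= `|intvec R (const_mx 1 : 'cV[int]_n)| <= t.
Proof.
move=> n0 t1; apply/andP; split.
  by apply: (@intvec_norm_ge1 _ _ _ (Ordinal n0)); rewrite mxE.
apply: normcV_leP => [|i]; first exact: le_trans t1.
by rewrite !mxE normr1.
Qed.

Lemma psi_le1 (R : realType) (m n : nat) (Om : 'M[R]_(m, n)) (t : R) :
  (0 < n)%N -> 1 <= t -> psi Om t <= 1.
Proof.
move=> n0 t1.
set v := Om *m intvec R (const_mx 1).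
apply: le_trans (psi_le Om (\col_j - Num.floor (v j ord0))
  (const1_norm n0 t1)) _.
apply: normcV_leP => // j.
rewrite -/v mxE [intvec _ _ _ _]mxE [X in X%:~R]mxE rmorphN /=.
have /andP[f1 f2] := floor_itv (v j ord0).
by rewrite ger0_norm ?subr_ge0// lerBlDr addrC (le_trans (ltW f2))// intrD1.
Qed.

Lemma mulmx_dist_le (R : realType) (m n : nat) (A B : 'M[R]_(m, n))
    (v : 'cV[R]_n) (d : R) :
  0 <= d -> (forall j i, `|A j i - B j i| <= d) ->
  `|A *m v - B *m v| <= n%:R * (d * `|v|).
Proof.
move=> d0 dAB; rewrite -mulmxBl.
apply: normcV_leP => [|j]; first by rewrite !mulr_ge0.
rewrite mxE; apply: le_trans (ler_norm_sum _ _ _) _.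
apply: (@le_trans _ _ (\sum_(i < n) d * `|v|)).
  apply: ler_sum => i _; rewrite normrM ler_pM// ?normcV_le//.
  by rewrite !mxE.
by rewrite sumr_const card_ord -(mulr_natl (d * _)).
Qed.

Lemma psi_lip (R : realType) (m n k : nat) (A B : 'M[R]_(m, n)) (d : R) :
  (0 < n)%N -> (0 < k)%N -> 0 <= d -> (forall j i, `|A j i - B j i| <= d) ->
  psi A k%:R <= psi B k%:R + n%:R * (d * k%:R).
Proof.
move=> n0 k0 d0 dAB; rewrite -lerBlDr.
apply: psi_ge => // [|b c bk]; first by rewrite ler1n.
rewrite lerBlDr; apply: le_trans (psi_le A c bk) _.
have -> : A *m intvec R b + intvec R c = (B *m intvec R b + intvec R c) +
    (A *m intvec R b - B *m intvec R b).
  by rewrite addrAC addrCA subrr addr0.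
apply: le_trans (ler_normD _ _) _; rewrite lerD2l.
apply: le_trans (mulmx_dist_le _ d0 dAB) _.
by rewrite !ler_wpM2l//; case/andP: bk.
Qed.

Lemma exprD_lip (R : realType) (m : nat) (x y d : R) :
  0 <= x <= 1 -> 0 <= y <= 1 -> 0 <= d -> x <= y + d ->
  x ^+ m <= y ^+ m + m%:R * d.
Proof.
move=> /andP[x0 x1] /andP[y0 y1] d0 xyd; elim: m => [|m IH].
  by rewrite !expr0 mul0r addr0.
have ym0 : 0 <= y ^+ m <= 1 by rewrite exprn_ge0// exprn_ile1.
rewrite !exprS; apply: le_trans (_ : x * (y ^+ m + m%:R * d) <= _).
  by rewrite ler_wpM2l.
have md : 0 <= m%:R * d by rewrite mulr_ge0.
move: (y ^+ m) ym0 => Y /andP[Y0 Y1].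
rewrite mulrDr -natr1 mulrDl mul1r.
have : x * Y <= y * Y + d.
  apply: le_trans (_ : (y + d) * Y <= _); first by rewrite ler_wpM2r.
  by rewrite mulrDl lerD2l ler_piMr.
have : x * (m%:R * d) <= m%:R * d by rewrite ler_piMl.
lra.
Qed.

(** The [m]-th power of the supremum of [t `^ (n / m) * psi Om t] over
    [k <= t < k.+1]; working with powers keeps real exponents out of the
    constructions. *)
Definition dirichlet_ratio (R : realType) (m n : nat) (Om : 'M[R]_(m, n))
    (k : nat) : R := k.+1%:R ^+ n * psi Om k%:R ^+ m.

(** A Lipschitz constant of [Om |-> dirichlet_ratio Om k], for the maximum norm
    and uniform in [k <= K]. *)
Definition lip_const (m n K : nat) : nat := (K.+1 ^ n * (m * (n * K)))%N.

Lemma dirichlet_ratio_lip (R : realType) (m n k K : nat) (A B : 'M[R]_(m, n))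
    (d : R) :
  (0 < n)%N -> (0 < k <= K)%N -> 0 <= d ->
  (forall j i, `|A j i - B j i| <= d) ->
  dirichlet_ratio A k <=
    dirichlet_ratio B k + (lip_const m n K)%:R * d.
Proof.
move=> n0 /andP[k0 kK] d0 dAB; rewrite /dirichlet_ratio /lip_const.
have k1 : 1 <= k%:R :> R by rewrite ler1n.
have h := psi_lip n0 k0 d0 dAB.
have dk0 : 0 <= n%:R * (d * k%:R) by rewrite !mulr_ge0.
have /(exprD_lip m) h1 : 0 <= psi A k%:R <= 1 by rewrite psi_ge0 psi_le1.
have /h1 {h1} h2 : 0 <= psi B k%:R <= 1 by rewrite psi_ge0 psi_le1.
have {h h2} := h2 _ dk0 h.
set Y := psi B _ ^+ m => h.
apply: le_trans (_ : k.+1%:R ^+ n * (Y + m%:R * (n%:R * (d * k%:R))) <= _).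
  by rewrite ler_wpM2l// exprn_ge0.
rewrite mulrDr lerD2l.
have -> : (K.+1 ^ n * (m * (n * K)))%:R * d =
  K.+1%:R ^+ n * (m%:R * (n%:R * (d * K%:R))) :> R.
  by rewrite !natrM natrX; ring.
apply: ler_pM; rewrite ?exprn_ge0 ?mulr_ge0//.
  by apply: lerXn2r; rewrite ?nnegrE// ler_nat ltnS.
by rewrite !ler_wpM2l// ler_nat.
Qed.

(** * From the normalised minima to Theta *)

Lemma powR_div_expr (R : realType) (m n : nat) (t : R) : (0 < m)%N -> 0 <= t ->
  (t `^ (n%:R / m%:R)) ^+ m = t ^+ n.
Proof.
move=> m0 t0; rewrite -powR_mulrn ?powR_ge0// -powRrM divfK.
  by rewrite powR_mulrn.
by rewrite pnatr_eq0 -lt0n.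
Qed.

Lemma Theta_le (R : realType) (m n : nat) (Om : 'M[R]_(m, n)) (lam : R) :
  (0 < m)%N -> (0 < n)%N -> 0 <= lam ->
  (forall e : R, 0 < e -> exists K, forall k, (K <= k)%N ->
     dirichlet_ratio Om k <= lam ^+ m + e) ->
  (Theta Om <= lam%:E)%E.
Proof.
move=> m0 n0 lam0 h; apply/lee_addgt0Pr => e e0.
have le0 : 0 <= lam + e by rewrite addr_ge0// ltW.
have d0 : 0 < (lam + e) ^+ m - lam ^+ m.
  by rewrite subr_gt0 ltrXn2r// -?lt0n// ltrDl.
have [K HK] := h _ d0.
pose V := [set t : R | K.+1%:R < t].
pose f (t : R) : \bar R := (t `^ (n%:R / m%:R) * psi Om t)%:E.
apply: (@le_trans _ _ (ereal_sup (f @` V))).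
  apply: ereal_inf_lbound; exists V => //.
  by exists K.+1%:R; split; rewrite ?num_real.
apply: ge_ereal_sup => _ [t /= Kt <-]; rewrite -EFinD lee_fin.
have t0 : 0 <= t by apply: le_trans (ltW Kt).
have /andP[kt tk] := truncn_itv t0; set k := Num.trunc t in kt tk.
have Kk : (K.+1 <= k)%N by rewrite /k truncn_ge_nat// ltW.
have k1 : 1 <= k%:R :> R by rewrite ler1n (leq_trans _ Kk).
have ps := psi_anti Om n0 k1 kt.
rewrite -(@ler_pXn2r _ m)// ?nnegrE ?mulr_ge0 ?powR_ge0 ?psi_ge0//.
rewrite exprMn powR_div_expr//.
have := HK k (ltnW Kk); rewrite addrC subrK; apply: le_trans.
apply: ler_pM; rewrite ?exprn_ge0// ?psi_ge0//.
  by apply: lerXn2r; rewrite ?nnegrE// ltW.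
by apply: lerXn2r; rewrite ?nnegrE// ?psi_ge0.
Qed.

(** Bernoulli's inequality for [k / k.+1 = 1 - 1 / k.+1]. *)
Lemma expr_succ_ratio_ge (R : realType) (n k : nat) :
  k.+1%:R ^+ n * (1 - n%:R / k.+1%:R) <= k%:R ^+ n :> R.
Proof.
have k0 : 0 < k.+1%:R :> R by [].
elim: n => [|n IH]; first by rewrite !expr0 mul1r mul0r subr0.
rewrite [leRHS]exprS.
apply: (@le_trans _ _ (k%:R * (k.+1%:R ^+ n * (1 - n%:R / k.+1%:R)))).
  rewrite exprS mulrAC [leRHS]mulrCA mulrC ler_wpM2l ?exprn_ge0//.
  have -> : k%:R = k.+1%:R - 1 :> R by rewrite -natr1 addrK.
  rewrite -[n.+1%:R]natr1; set x : R := k.+1%:R in k0 *.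
  have -> : x * (1 - (n%:R + 1) / x) = x - n%:R - 1 by field; lra.
  have -> : (x - 1) * (1 - n%:R / x) = x - n%:R - 1 + n%:R / x by field; lra.
  by rewrite lerDl divr_ge0// ltW.
by rewrite ler_wpM2l.
Qed.

Lemma Theta_ge (R : realType) (m n : nat) (Om : 'M[R]_(m, n)) (lam : R) :
  (0 < m)%N -> (0 < n)%N ->
  (forall (e : R) K, 0 < e -> exists2 k, (K <= k)%N &
     lam ^+ m - e <= dirichlet_ratio Om k) ->
  (lam%:E <= Theta Om)%E.
Proof.
move=> m0 n0 h; apply/lee_subgt0Pr => e e0.
apply: le_ereal_inf_tmp => _ [V [M [_ MV]] <-].
suff [t Mt lt] : exists2 t : R, M < t &
    lam - e <= t `^ (n%:R / m%:R) * psi Om t.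
  apply: le_trans (ereal_sup_ubound _); last first.
    by exists t; [exact: MV|reflexivity].
  by rewrite -EFinB lee_fin.
have [le0|le0] := leP (lam - e) 0.
  exists (M + 1); first by rewrite ltrDl.
  by apply: le_trans le0 _; rewrite mulr_ge0 ?powR_ge0 ?psi_ge0.
have lam0 : 0 < lam by rewrite (lt_le_trans le0)// gerBl ltW.
pose L := lam ^+ m; have L0 : 0 < L by rewrite exprn_gt0.
(* half of the gap absorbs the error in [h], the other half the passage from
   [k.+1] to [k] *)
pose d := (L - (lam - e) ^+ m) / 2.
have d0 : 0 < d.
  rewrite divr_gt0// subr_gt0 ltrXn2r// -?lt0n// ?gtrBl//; exact: ltW.
pose K := (Num.trunc (`|M| + 1 + L * n%:R / d)).+1.
have [k Kk lk] := h d K d0.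
have kK : `|M| + 1 + L * n%:R / d < k%:R.
  by apply: lt_le_trans (truncnS_gt _) _; rewrite ler_nat.
have Ln0 : 0 <= L * n%:R / d by rewrite !mulr_ge0 ?invr_ge0// ltW.
exists k%:R.
  apply: le_lt_trans kK; apply: le_trans (ler_norm M) _; rewrite -addrA lerDl.
  by rewrite addr_ge0.
rewrite -(@ler_pXn2r _ m)// ?nnegrE ?mulr_ge0 ?powR_ge0 ?psi_ge0 ?(ltW le0)//.
rewrite exprMn powR_div_expr//.
apply: (@le_trans _ _ (dirichlet_ratio Om k * (1 - n%:R / k.+1%:R))); last first.
  rewrite /dirichlet_ratio mulrAC ler_wpM2r ?exprn_ge0 ?psi_ge0//.
  exact: expr_succ_ratio_ge.
have k0 : 0 < k.+1%:R :> R by [].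
have Lnd : L * (n%:R / k.+1%:R) <= d.
  rewrite mulrA ler_pdivrMr// -ler_pdivrMl// mulrC.
  rewrite (le_trans _ (ltW (lt_trans kK _)))//.
    by rewrite lerDr addr_ge0.
  by rewrite ltr_nat.
have nk1 : n%:R / k.+1%:R <= 1 :> R.
  rewrite ler_pdivrMr// mul1r.
  have : L * (n%:R / k.+1%:R) <= L.
    apply: le_trans Lnd _; rewrite /d ler_pdivrMr//.
    have : 0 <= (lam - e) ^+ m by rewrite exprn_ge0// ltW.
    by move: L0; lra.
  by rewrite ger_pMr// ler_pdivrMr// mul1r.
apply: (@le_trans _ _ ((L - d) * (1 - n%:R / k.+1%:R))); last first.
  by rewrite ler_wpM2r// subr_ge0.
have nk0 : 0 <= n%:R / k.+1%:R :> R by rewrite divr_ge0.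
have : 0 <= d * (n%:R / k.+1%:R) by rewrite mulr_ge0// ltW.
have -> : (lam - e) ^+ m = L - 2 * d by rewrite /d; field.
by move: Lnd; move: (n%:R / k.+1%:R) => z; lra.
Qed.

(** * Realising a prescribed limit superior by stages *)

(** The intervals of centre [u s] and radius [d s] meet pairwise, hence all of
    them share the supremum of their left ends. *)
Lemma nested_limit (R : realType) (u d : nat -> R) :
  (forall s r, `|u (s + r)%N - u s| <= d s) ->
  exists l, forall s, `|l - u s| <= d s.
Proof.
move=> h.
have lo s r : u s - d s <= u r + d r.
  have [/subnKC sr|/ltnW/subnKC rs] := leqP s r.
    have := h s (r - s)%N; rewrite sr ler_norml => /andP[+ _].
    have : 0 <= d r by apply: le_trans (normr_ge0 _) (h r 0%N).
    by lra.
  have := h r (s - r)%N; rewrite rs ler_norml => /andP[_].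
  have : 0 <= d s by apply: le_trans (normr_ge0 _) (h s 0%N).
  by lra.
pose A := range (fun s => u s - d s).
have A0 : A !=set0 by exists (u 0%N - d 0%N), 0%N.
have uA s : ubound A (u s + d s) by move=> _ [r _ <-]; exact: lo.
exists (sup A) => s; rewrite ler_distl; apply/andP; split.
  by apply: ub_le_sup; [exists (u 0%N + d 0%N); exact: uA | exists s].
exact: ge_sup.
Qed.

Lemma lip_const_mono (m n K K' : nat) : (K <= K')%N ->
  (lip_const m n K <= lip_const m n K')%N.
Proof.
move=> KK'; rewrite /lip_const; apply: leq_mul; last by rewrite !leq_mul.
by case: n => // n; rewrite leq_exp2r.
Qed.

(** [St Om T] is an invariant that makes a further stage, beginning at time [T],
    possible.  The precision of a stage is chosen after the previous one, so
    small that all later stages together move each [dirichlet_ratio] before [T]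
    by a negligible amount. *)
Lemma exists_limit_of_stages (R : realType) (m n : nat) (L : R)
    (St : 'M[R]_(m, n) -> nat -> Prop) :
  (0 < n)%N ->
  (exists Om T, (0 < T)%N /\ St Om T) ->
  (forall Om T e, (0 < T)%N -> St Om T -> 0 < e -> exists Om' T',
     [/\ St Om' T', (T < T')%N,
         forall j i, `|Om' j i - Om j i| <= e,
         forall k, (T <= k < T')%N -> dirichlet_ratio Om' k <= L + e
       & exists2 k, (T <= k < T')%N & L - e <= dirichlet_ratio Om' k]) ->
  exists Om : 'M[R]_(m, n),
    (forall e, 0 < e -> exists K, forall k, (K <= k)%N ->
       dirichlet_ratio Om k <= L + e) /\
    (forall e K, 0 < e -> exists2 k, (K <= k)%N &
       L - e <= dirichlet_ratio Om k).
Proof.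
move=> n0 [Om0 [T0 [T00 St0]]] step.
pose X := {p : 'M[R]_(m, n) * nat | (0 < p.2)%N /\ St p.1 p.2}.
pose om (x : X) := (sval x).1; pose tm (x : X) := (sval x).2.
pose del s (x : X) : R := 2^-1 ^+ s / (lip_const m n (tm x)).+1%:R.
have del0 s x : 0 < del s x by rewrite divr_gt0// exprn_gt0.
have del_le s x : del s x <= 2^-1 ^+ s.
  by rewrite ler_pdivrMr// ler_peMr ?exprn_ge0// ler1n.
have lipdel s x : (lip_const m n (tm x))%:R * del s x <= 2^-1 ^+ s.
  by rewrite mulrCA ger_pMr ?exprn_gt0// ler_pdivrMr// mul1r ler_nat.
pose P (sx : nat * X) (y : X) := let e := del sx.1 sx.2 / 2 in
  [/\ (tm sx.2 < tm y)%N,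
     forall j i, `|om y j i - om sx.2 j i| <= e,
     forall k, (tm sx.2 <= k < tm y)%N -> dirichlet_ratio (om y) k <= L + e
   & exists2 k, (tm sx.2 <= k < tm y)%N & L - e <= dirichlet_ratio (om y) k].
have [f fP] : {f : nat * X -> X & forall sx, P sx (f sx)}.
  apply: choice => -[s x]; have [x0 xS] := svalP x.
  have e0 : 0 < del s x / 2 by rewrite divr_gt0.
  have [Om' [T' [St' TT' d1 d2 d3]]] := step _ _ _ x0 xS e0.
  have y0 : (0 < (Om', T').2)%N /\ St (Om', T').1 (Om', T').2.
    by split => //=; apply: leq_ltn_trans TT'.
  by exists (exist _ (Om', T') y0).
pose x := fix x s : X := if s is s'.+1 then f (s', x s') else
  exist _ (Om0, T0) (conj T00 St0).
have xS s : P (s, x s) (x s.+1) := fP (s, x s).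
pose d s := del s (x s).
have TS s : (tm (x s) < tm (x s.+1))%N by case: (xS s).
have T_ge s : (s < tm (x s))%N.
  elim: s => [|s IH]; first by case: (svalP (x 0%N)).
  exact: leq_trans (TS s).
have dS s : d s.+1 <= d s / 2.
  rewrite /d /del exprS -!mulrA mulrC -mulrA ler_wpM2l ?exprn_ge0//.
  rewrite ler_wpM2r// lef_pV2 ?posrE// ler_nat ltnS lip_const_mono//.
  exact: ltnW.
have hd r s j i : `|om (x (s + r)%N) j i - om (x s) j i| <= d s.
  elim: r s => [|r IH] s.
    by rewrite addn0 subrr normr0; exact: (ltW (del0 _ _)).
  rewrite addnS -addSn.
  apply: le_trans (ler_distD (om (x s.+1) j i) _ _) _.
  rewrite [leRHS]splitr; apply: lerD; first exact: le_trans (IH _) (dS s).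
  by case: (xS s).
pose lim j i := nested_limit (fun s r => hd r s j i).
pose Om : 'M[R]_(m, n) := \matrix_(j, i) sval (cid (lim j i)).
have OmE s j i : `|Om j i - om (x s) j i| <= d s.
  by rewrite mxE; case: cid.
(* the ratio at a time of stage [s] is settled by the matrix [s.+1] *)
have near s k : (tm (x s) <= k < tm (x s.+1))%N ->
    dirichlet_ratio Om k <= dirichlet_ratio (om (x s.+1)) k + 2^-1 ^+ s.+1 /\
    dirichlet_ratio (om (x s.+1)) k <= dirichlet_ratio Om k + 2^-1 ^+ s.+1.
  move=> /andP[k1 k2].
  have k0 : (0 < k <= tm (x s.+1))%N.
    by rewrite (ltnW k2) andbT (leq_trans _ k1)//; apply: leq_ltn_trans (T_ge s).
  split; apply: le_trans (dirichlet_ratio_lip n0 k0 (ltW (del0 s.+1 (x s.+1))) _) _.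
  - exact: OmE.
  - by rewrite lerD2l lipdel.
  - by move=> j i; rewrite distrC; exact: OmE.
  - by rewrite lerD2l lipdel.
have half (e : R) : 0 < e -> exists s, 2^-1 ^+ s < e.
  move=> e0; exists (Num.trunc e^-1).+1.
  have := truncnS_gt e^-1; set N := (_.+1)%N => Ne.
  have N2 : N%:R < 2%:R ^+ N :> R by rewrite -natrX ltr_nat ltn_expl.
  rewrite exprVn -[ltRHS]invrK ltf_pV2 ?posrE ?exprn_gt0 ?invr_gt0//.
  exact: lt_trans N2.
have err s : d s / 2 + 2^-1 ^+ s.+1 <= 2^-1 ^+ s.
  have := del_le s (x s); rewrite -/(d s) exprS; lra.
exists Om; split => [e e0|e K e0].
  have [s0 hs0] := half e e0; exists (tm (x s0)) => k Kk.
  have [s [s0s sk]] : exists s, (s0 <= s)%N /\ (tm (x s) <= k < tm (x s.+1))%N.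
    have [r] : exists r, (k < tm (x (s0 + r)%N))%N.
      by exists k.+1; apply: leq_ltn_trans (T_ge _); lia.
    elim: r => [|r IH]; first by rewrite addn0 ltnNge Kk.
    rewrite addnS => kr; have [/IH//|kr'] := ltnP k (tm (x (s0 + r)%N)).
    by exists (s0 + r)%N; rewrite kr' kr leq_addr.
  have [n1 _] := near s k sk; have [_ _ /(_ k sk) /= up _] := xS s.
  have : (2^-1 : R) ^+ s <= 2^-1 ^+ s0.
    by rewrite ler_wiXn2l//; lra.
  have := err s; rewrite /d; lra.
have [s0 hs0] := half e e0.
pose s := maxn s0 K.
have [_ _ _ [k sk /= low]] := xS s; exists k.
  have /andP[+ _] := sk; apply: leq_trans; apply: leq_trans (ltnW (T_ge s)).
  exact: leq_maxr.
have [_ n1] := near s k sk.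
have : (2^-1 : R) ^+ s <= 2^-1 ^+ s0.
  by rewrite ler_wiXn2l ?leq_maxl//; lra.
have := err s; rewrite /d; lra.
Qed.

(** * The upper bound by one *)

(** Distribute the [k.+1 ^ n] vectors with entries in [0, ..., k] according to
    the box of side [1 / N.+1] that contains the fractional parts of [Om b]; two
    vectors in one box differ by a good approximation. *)
Lemma psi_pigeonhole (R : realType) (m n k N : nat) (Om : 'M[R]_(m, n)) :
  (0 < n)%N -> (0 < k)%N -> (N.+1 ^ m < k.+1 ^ n)%N ->
  psi Om k%:R <= N.+1%:R^-1.
Proof.
move=> n0 k0 Nk.
pose b (a : {ffun 'I_n -> 'I_k.+1}) : 'cV[int]_n := \col_i (a i : nat)%:Z.
pose y a j := (Om *m intvec R (b a)) j ord0.
pose fr (x : R) := x - (Num.floor x)%:~R.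
have fr01 x : 0 <= fr x < 1.
  have /andP[f1 f2] := floor_itv x; rewrite /fr.
  by rewrite subr_ge0 f1 ltrBlDl -intrD1.
have Nfr x : 0 <= N.+1%:R * fr x < N.+1%:R.
  have /andP[f1 f2] := fr01 x.
  by rewrite mulr_ge0//= gtr_pMr.
pose box a : {ffun 'I_m -> 'I_N.+1} :=
  [ffun j => inord (Num.trunc (N.+1%:R * fr (y a j)))].
have : ~~ injectiveb box.
  apply/negP => /injectiveP/leq_card; rewrite !card_ffun !card_ord.
  by rewrite leqNgt Nk.
move=> /injectivePn[a [a' aa' baa']].
have fE a0 j : (box a0 j : nat) = Num.trunc (N.+1%:R * fr (y a0 j)).
  by rewrite ffunE inordK// truncn_lt_nat; case/andP: (Nfr (y a0 j)).
pose d : 'cV[int]_n := b a - b a'.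
pose c : 'cV[int]_m := \col_j (Num.floor (y a' j) - Num.floor (y a j)).
apply: le_trans (psi_le Om (b := d) c _) _; last first.
  apply: normcV_leP => [|j]; first by rewrite invr_ge0.
  have -> : (Om *m intvec R d + intvec R c) j ord0 = fr (y a j) - fr (y a' j).
    rewrite [LHS]mxE.
    have -> : intvec R d = intvec R (b a) - intvec R (b a').
      by rewrite /intvec map_mxB.
    rewrite mulmxBr [X in X + _]mxE [X in _ + X + _]mxE -!/(y _ _).
    rewrite [intvec R c j ord0]mxE [c _ _]mxE intrB /fr; ring.
  have := fE a j; rewrite baa' fE => tE.
  have /andP[h1 h2] := Nfr (y a j); have /andP[h3 h4] := Nfr (y a' j).
  have /andP[] := truncn_itv h1; have /andP[] := truncn_itv h3.
  rewrite tE; move: (Num.trunc _) => q.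
  rewrite -[q.+1%:R]natr1 => l1 l2 l3 l4.
  rewrite -(ler_pM2l (ltr0Sn R N)) divff ?pnatr_eq0//.
  rewrite -[X in X * `|_|]ger0_norm// -normrM mulrBr ler_norml.
  by apply/andP; split; lra.
have [i ai] : exists i, a i != a' i.
  apply/existsP; apply: contraNT aa' => /existsPn h.
  by apply/eqP/ffunP => i; apply/eqP/negPn.
apply/andP; split.
  apply: (@intvec_norm_ge1 _ _ _ i); rewrite !mxE subr_eq0 eqz_nat.
  exact: ai.
apply: normcV_leP => // i'; rewrite !mxE -intr_norm -[k%:R]/((k%:Z)%:~R) ler_int.
have := ltn_ord (a i'); have := ltn_ord (a' i').
move: (nat_of_ord (a i')) (nat_of_ord (a' i')) => p p' p'k pk.
lia.
Qed.

(** For [N] maximal in the pigeonhole argument, [k.+1 ^ n <= N.+2 ^ m], so the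
    ratio is at most [(N.+2 / N.+1) ^ m], which tends to 1. *)
Lemma Theta_le1 (R : realType) (m n : nat) (Om : 'M[R]_(m, n)) :
  (0 < m)%N -> (0 < n)%N -> (Theta Om <= 1%:E)%E.
Proof.
move=> m0 n0; apply: Theta_le => // e e0; rewrite expr1n.
pose N0 := (Num.trunc (m%:R * (1 + e) / e)).+1.
exists (N0.+1 ^ m)%N => k Kk.
have k0 : (0 < k)%N by apply: leq_trans Kk; rewrite expn_gt0.
pose Q N := (N.+1 ^ m < k.+1 ^ n)%N.
have Q0 : Q N0.
  rewrite /Q; apply: leq_ltn_trans Kk _.
  by rewrite -[X in (X <= _)%N]expn1 leq_pexp2l.
have Qb N : Q N -> (N <= k.+1 ^ n)%N.
  rewrite /Q => /ltnW; apply: leq_trans; apply: leq_trans (leqnSn _) _.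
  by case: (m) m0 => // m' _; rewrite expnS leq_pmulr// expn_gt0.
have [N QN Nmax] := ex_maxnP (ex_intro Q N0 Q0) Qb.
have N0N : (N0 <= N)%N by exact: Nmax.
have QS : (k.+1 ^ n <= N.+2 ^ m)%N.
  by rewrite leqNgt; apply/negP => /(Nmax N.+1); rewrite ltnn.
have ps := psi_pigeonhole Om n0 k0 QN.
rewrite /dirichlet_ratio.
apply: (@le_trans _ _ (N.+2%:R ^+ m * N.+1%:R^-1 ^+ m)).
  apply: ler_pM; rewrite ?exprn_ge0 ?psi_ge0//.
    by rewrite -!natrX ler_nat.
  by apply: lerXn2r; rewrite ?nnegrE ?psi_ge0.
have Np : 0 < N.+1%:R ^+ m :> R by rewrite exprn_gt0.
rewrite exprVn ler_pdivrMr//.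
have := expr_succ_ratio_ge R m N.+1; set x : R := m%:R / _ => h.
have Nm0 : 0 < N.+2%:R ^+ m :> R by rewrite exprn_gt0.
suff hx : 1 <= (1 + e) * (1 - x).
  apply: le_trans (_ : (1 + e) * (N.+2%:R ^+ m * (1 - x)) <= _); last first.
    by rewrite ler_wpM2l// addr_ge0// ltW.
  by rewrite mulrCA ler_peMr// ltW.
have : x * (1 + e) <= e.
  rewrite /x mulrAC ler_pdivrMr// -ler_pdivrMl// mulrC.
  apply: le_trans (ltW (truncnS_gt _)) _; rewrite ler_nat -/N0.
  exact: leq_trans N0N (leq_trans (leqnSn _) (leqnSn _)).
lra.
Qed.

(** * Block diagonal matrices *)

Fixpoint block_diag (R : realType) (m n : nat) (Om : 'M[R]_(m, n)) (k : nat) :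
    'M[R]_(k * m, k * n) :=
  if k is k'.+1 then block_mx Om 0 0 (block_diag Om k') else 0.

Lemma norm_col_mx (R : realType) (p q : nat) (u : 'cV[R]_p) (v : 'cV[R]_q) :
  `|col_mx u v| = Num.max `|u| `|v|.
Proof.
apply/eqP; rewrite eq_le; apply/andP; split.
  apply: normcV_leP => [|i]; first by rewrite le_max normr_ge0.
  rewrite mxE; case: split_ordP => j _; rewrite le_max normcV_le ?orbT//.
rewrite ge_max; apply/andP; split; apply: normcV_leP => // i.
  by rewrite -(col_mxEu u v); apply: normcV_le.
by rewrite -(col_mxEd u v); apply: normcV_le.
Qed.

Lemma intvec_col_mx (R : realType) (p q : nat) (b : 'cV[int]_p)
    (b' : 'cV[int]_q) :
  intvec R (col_mx b b') = col_mx (intvec R b) (intvec R b').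
Proof. exact: map_col_mx. Qed.

Lemma intvec0 (R : realType) (p : nat) : intvec R (0 : 'cV[int]_p) = 0.
Proof. by apply/colP => i; rewrite !mxE. Qed.

Lemma block_mul_col (R : realType) (m n m' n' : nat) (A : 'M[R]_(m, n))
    (A' : 'M[R]_(m', n')) (b : 'cV[int]_n) (b' : 'cV[int]_n') c c' :
  `|block_mx A 0 0 A' *m intvec R (col_mx b b') + intvec R (col_mx c c')| =
  Num.max `|A *m intvec R b + intvec R c| `|A' *m intvec R b' + intvec R c'|.
Proof.
rewrite !intvec_col_mx mul_block_col !mul0mx addr0 add0r.
by rewrite add_col_mx norm_col_mx.
Qed.

(** Some block of a nonzero vector is nonzero, and the linear forms on that
    block are among those of the whole matrix. *)
Lemma block_diag_reduce (R : realType) (m n : nat) (Om : 'M[R]_(m, n)) (t : R)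
    k (b : 'cV[int]_(k * n)) (c : 'cV[int]_(k * m)) :
  1 <= `|intvec R b| <= t -> exists b' c', 1 <= `|intvec R b'| <= t /\
   `|Om *m intvec R b' + intvec R c'| <=
   `|block_diag Om k *m intvec R b + intvec R c|.
Proof.
elim: k b c => [|k IH] b c bt.
  by case/andP: bt => /intvec_neq0[[]].
move: b c bt.
change ((forall (b : 'cV[int]_(n + k * n)) (c : 'cV[int]_(m + k * m)),
  1 <= `|intvec R b| <= t -> exists b' c', 1 <= `|intvec R b'| <= t /\
   `|Om *m intvec R b' + intvec R c'| <=
   `|block_mx Om 0 0 (block_diag Om k) *m intvec R b + intvec R c|)).
move=> b c; rewrite -(vsubmxK b) -(vsubmxK c) block_mul_col.
rewrite intvec_col_mx norm_col_mx.
set b1 := usubmx b; set b2 := dsubmx b; set c1 := usubmx c.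
set c2 := dsubmx c => bt.
have bt' : `|intvec R b1| <= t /\ `|intvec R b2| <= t.
  by move: bt; rewrite ge_max => /and3P[].
have [b1n|b1n] := leP 1 `|intvec R b1|.
  exists b1, c1; split; first by rewrite b1n; case: bt'.
  by rewrite le_max lexx.
have b2n : 1 <= `|intvec R b2|.
  by move: bt; rewrite le_max leNgt b1n /= => /andP[].
have [|b' [c' [bt1 h]]] := IH b2 c2; first by rewrite b2n; case: bt'.
by exists b', c'; split => //; rewrite le_max h orbT.
Qed.

Lemma psi_block_diag (R : realType) (m n k : nat) (Om : 'M[R]_(m, n)) (t : R) :
  (0 < k)%N -> (0 < n)%N -> psi (block_diag Om k) t = psi Om t.
Proof.
move=> k0 n0; have [t1|t1] := ltP t 1.
  have e p q (A : 'M[R]_(p, q)) : psi A t = 0.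
    rewrite /psi; suff -> : approx_values A t = set0 by rewrite inf0.
    apply/seteqP; split => // x [b [c [/andP[b1 bt] _]]].
    by have := le_trans b1 bt; rewrite leNgt t1.
  by rewrite !e.
have kn0 : (0 < k * n)%N by rewrite muln_gt0 k0.
apply/eqP; rewrite eq_le; apply/andP; split; last first.
  apply: psi_ge => // b c /(block_diag_reduce Om c) [b' [c' [bt h]]].
  exact: le_trans (psi_le _ _ bt) h.
apply: psi_ge => // b c bt; case: k k0 kn0 => // k _ _.
apply: (@le_trans _ _ `|block_diag Om k.+1 *m
  intvec R (col_mx b (0 : 'cV_(k * n))) + intvec R (col_mx c (0 : 'cV_(k * m)))|).
  apply: (@psi_le _ (k.+1 * m) (k.+1 * n)).
  rewrite (@intvec_col_mx _ n (k * n)) norm_col_mx intvec0 normr0.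
  by rewrite max_l.
rewrite /= block_mul_col !intvec0 mulmx0 addr0 normr0 max_l//.
Qed.

Lemma Dirichlet_spectrum_scale (R : realType) (k m n : nat) :
  (0 < k)%N -> (0 < n)%N ->
  Dirichlet_spectrum R m n `<=` Dirichlet_spectrum R (k * m) (k * n).
Proof.
move=> k0 n0 _ [Om _ <-]; exists (block_diag Om k) => //.
rewrite /Theta; congr limf_esup; apply/funext => t.
rewrite psi_block_diag//; congr ((_ `^ _ * _)%:E).
by rewrite !natrM -mulf_div divff ?mul1r// pnatr_eq0 -lt0n.
Qed.

(** * Matrices whose small linear forms are critical *)

Lemma dvdz_small0 (d x : int) : (d %| x)%Z -> `|x| < d -> x = 0.
Proof.
move=> /dvdzP[q ->]; have [->|q0] := eqVneq q 0; first by rewrite mul0r.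
rewrite normrM => h; exfalso; move: h; apply/negP; rewrite -leNgt.
apply: le_trans (ler_norm d) _; rewrite ler_peMl//.
by rewrite -gtz0_ge1 normr_gt0.
Qed.

(** The digit-by-digit induction behind the critical matrices.  If
    [D ^ p] divides every [b i * D ^ (i * m)], then digit [p] of the expansion
    lies in [b i] for [i = p %/ m] and is read by row [j = p %/ n]: earlier
    entries already vanish, later ones contribute multiples of [D ^ p.+1], and
    the unit [U j i] does not affect divisibility by [D ^ p.+1]. *)
Lemma digits_vanish (m n D : nat) (U : 'I_m -> 'I_n -> int) (b : 'I_n -> int)
    (c : 'I_m -> int) :
  (0 < D)%N ->
  (forall j i, coprimez (U j i) D%:Z) ->
  (forall i, `|b i| < D%:Z ^+ m) ->
  (forall j : 'I_m,
     `|\sum_(i < n | (i * m < j.+1 * n)%N) U j i * (b i * D%:Z ^+ (i * m)) +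
       c j * D%:Z ^+ (j.+1 * n)| < D%:Z ^+ (j * n)) ->
  forall i, b i = 0.
Proof.
move=> D0 Uco bD row.
have Dz k : D%:Z ^+ k != 0 by rewrite expf_neq0// lt0r_neq0.
suff digits p : (p <= m * n)%N -> forall i, (D%:Z ^+ p %| b i * D%:Z ^+ (i * m))%Z.
  move=> i; apply: dvdz_small0 (bD i).
  have im : ((i * m) + m <= m * n)%N by have := ltn_ord i; nia.
  have := digits _ im i; rewrite addnC exprD dvdz_mul2r ?Dz//.
elim: p => [|p IH] pmn i; first by rewrite expr0 dvd1z.
have {}IH := IH (ltnW pmn).
have m0 : (0 < m)%N by case: (m) pmn.
have n0 : (0 < n)%N by case: (n) pmn; rewrite // muln0.
have jm : (p %/ n < m)%N by rewrite ltn_divLR.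
pose j := Ordinal jm.
have jp : (j * n <= p)%N by rewrite /= leq_divM.
have pj : (p < j.+1 * n)%N by rewrite /= ltn_ceil.
(* the row is a multiple of its own error bound, so it vanishes *)
have := row j; set V := (X in `|X|) => Vlt.
have V0 : V = 0.
  apply: dvdz_small0 Vlt; apply: rpredD; last first.
    by apply: dvdz_mull; rewrite dvdz_exp2l// leq_mul2r leqnSn orbT.
  apply: rpred_sum => i' _; apply: dvdz_mull.
  exact: dvdz_trans (dvdz_exp2l _ jp) (IH i').
have [il|il] := ltnP p (i * m).
  by apply: dvdz_mull; rewrite dvdz_exp2l.
have done_zero (i' : 'I_n) : (i'.+1 * m <= p)%N -> b i' = 0.
  move=> ip; apply: dvdz_small0 (bD i').
  have := dvdz_trans (dvdz_exp2l D%:Z ip) (IH i').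
  by rewrite mulSn exprD dvdz_mul2r ?Dz//.
have [li|li] := leqP (i.+1 * m) p; first by rewrite done_zero// mul0r dvdz0.
have iin : (i * m < j.+1 * n)%N by apply: leq_ltn_trans pj.
rewrite -(Gauss_dvdzr (m := D%:Z ^+ p.+1) (n := U j i)); last first.
  by apply: coprimezXl; rewrite coprimez_sym.
move: V0; rewrite /V (bigD1 i)//= -addrA => /eqP; rewrite addr_eq0 => /eqP ->.
rewrite rpredN; apply: rpredD; last by apply: dvdz_mull; rewrite dvdz_exp2l.
apply: rpred_sum => i' /andP[_ i'i]; apply: dvdz_mull.
have [lt|lt|/val_inj eqi] := ltngtP i i'; last by rewrite eqi eqxx in i'i.
  apply: dvdz_mull; rewrite dvdz_exp2l//.
  apply: leq_trans li _; rewrite leq_mul2r lt orbT//.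
by rewrite done_zero ?mul0r ?dvdz0// (leq_trans _ il)// leq_mul2r lt orbT.
Qed.

Lemma psi_le_near (R : realType) (m n : nat) (Om : 'M[R]_(m, n)) (t d : R) b :
  0 <= d -> 1 <= `|intvec R b| <= t ->
  (forall j, exists2 z, z \is a Num.int & `|(Om *m intvec R b) j ord0 - z| <= d) ->
  psi Om t <= d.
Proof.
move=> d0 bt near.
have {}near j : {z : R | z \is a Num.int &
    `|(Om *m intvec R b) j ord0 - z| <= d}.
  by apply: cid2; exact: near.
pose z j := s2val (near j).
apply: le_trans (psi_le Om (\col_j - Num.floor (z j)) bt) _.
apply: normcV_leP => // j.
rewrite mxE [intvec _ _ _ _]mxE [X in X%:~R]mxE rmorphN /=.
by rewrite floorK; [exact: (s2valP' (near j)) | exact: (s2valP (near j))].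
Qed.

Lemma psi_eq0 (R : realType) (m n : nat) (Om : 'M[R]_(m, n)) (t : R) b :
  1 <= `|intvec R b| <= t ->
  (forall j, (Om *m intvec R b) j ord0 \is a Num.int) -> psi Om t = 0.
Proof.
move=> bt Omb; apply/eqP; rewrite eq_le psi_ge0 andbT.
apply: (psi_le_near (lexx 0) bt) => j.
by exists ((Om *m intvec R b) j ord0); rewrite // subrr normr0.
Qed.

Lemma dirichlet_ratio_eq0 (R : realType) (m n k : nat) (Om : 'M[R]_(m, n)) b :
  (0 < m)%N -> 1 <= `|intvec R b| <= k%:R ->
  (forall j, (Om *m intvec R b) j ord0 \is a Num.int) ->
  dirichlet_ratio Om k = 0.
Proof.
move=> m0 bk Omb; rewrite /dirichlet_ratio (psi_eq0 bk Omb).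
by rewrite expr0n gtn_eqF// mulr0.
Qed.

Definition axis_vec (n : nat) (i : 'I_n) (N : nat) : 'cV[int]_n :=
  \col_i' (if i' == i then N%:Z else 0).

Lemma mulmx_axis_vec (R : realType) (m n N : nat) (A : 'M[R]_(m, n)) (i : 'I_n)
  (j : 'I_m) : (A *m intvec R (axis_vec i N)) j ord0 = A j i * N%:R.
Proof.
rewrite mxE (bigD1 i)//= big1 => [|i' i'i].
  by rewrite !mxE eqxx addr0.
by rewrite !mxE (negPf i'i) mulr0.
Qed.

Lemma axis_vec_norm (R : realType) (n N : nat) (t : R) (i : 'I_n) :
  (0 < N)%N -> N%:R <= t -> 1 <= `|intvec R (axis_vec i N)| <= t.
Proof.
move=> N0 Nt; apply/andP; split.
  by apply: (@intvec_norm_ge1 _ _ _ i); rewrite mxE eqxx; case: (N) N0.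
apply: normcV_leP => [|i']; first exact: le_trans Nt.
rewrite !mxE; case: eqP => _; last by rewrite normr0 (le_trans _ Nt).
by rewrite normr_nat.
Qed.

(** Entry [(j, i)] is [D ^ (i * m) / D ^ (j.+1 * n)], with the integral entries
    replaced by zero so that the matrix is small. *)
Definition digit_mx (R : realType) (m n D : nat) : 'M[R]_(m, n) :=
  \matrix_(j, i) if (i * m < j.+1 * n)%N
                 then (D%:R ^+ (j.+1 * n - i * m))^-1 else 0.

Lemma digit_mx_le (R : realType) (m n D : nat) (j : 'I_m) (i : 'I_n) :
  (0 < D)%N -> 0 <= digit_mx R m n D j i <= D%:R^-1.
Proof.
move=> D0; rewrite mxE; case: ifP => act; last by rewrite lexx invr_ge0 /=.
rewrite invr_ge0 exprn_ge0//= lef_pV2 ?posrE ?exprn_gt0 ?ltr0n//.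
rewrite -[leLHS]expr1; apply: ler_weXn2l; rewrite ?ler1n//.
by rewrite subn_gt0.
Qed.

(** Adding a matrix with much smaller powers of two as denominators only
    changes the entries of [digit_mx], once they are scaled to integers, from 1
    to odd numbers, so that [digits_vanish] applies.  The vanishing of [Om] at the
    places where [digit_mx] is zero keeps the digits in order: a row must not see
    an entry of [b] before its turn. *)
Lemma critical_psi_ge (R : realType) (m n q d k : nat) (Om : 'M[R]_(m, n)) :
  (0 < n)%N -> (q < d)%N ->
  (forall j i, 2%:R ^+ q * Om j i \is a Num.int) ->
  (forall (j : 'I_m) (i : 'I_n), (j.+1 * n <= i * m)%N -> Om j i = 0) ->
  (0 < k < (2 ^ d) ^ m)%N ->
  ((2 ^ d)%:R ^+ n)^-1 <= psi (Om + digit_mx R m n (2 ^ d)) k%:R.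
Proof.
move=> n0 qd dya pat /andP[k0 kD].
set D := (2 ^ d)%N in kD *; set Om1 := Om + _.
have D0 : (0 < D)%N by rewrite expn_gt0.
have D0R p : 0 < D%:R ^+ p :> R by rewrite exprn_gt0// ltr0n.
apply: psi_ge => //; first by rewrite ler1n.
move=> b c /andP[b1 bk]; rewrite leNgt; apply/negP => small.
have [i] := intvec_neq0 b1; apply/negP; rewrite negbK; apply/eqP; move: i.
pose ex (j : 'I_m) (i : 'I_n) := (j.+1 * n - i * m)%N.
(* [Om1] scaled by [D ^ ex] is [U = 1 + 2 * W]: the factor 2 comes from [q < d] *)
pose W j i : R := 2%:R ^+ (d * ex j i - q.+1) * (2%:R ^+ q * Om j i).
pose U j i : int := 1 + 2 * Num.floor (W j i).
have UE (j : 'I_m) (i : 'I_n) : (i * m < j.+1 * n)%N ->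
    D%:R ^+ ex j i * Om1 j i = (U j i)%:~R.
  move=> act; rewrite !mxE act mulrDr divff ?gt_eqF// addrC.
  rewrite /U rmorphD /= rmorphM /= floorK; last first.
    by rewrite rpredM// rpredX// rpred_nat.
  congr (_ + _). rewrite /W (_ : 2%:~R = 2%:R :> R)// mulrA mulrA -exprD -exprS.
  have ex0 : (0 < ex j i)%N by rewrite subn_gt0.
  rewrite /D natrX -exprM; congr (_ ^+ _ * _).
  have : (d <= d * ex j i)%N by rewrite leq_pmulr.
  by lia.
apply: (@digits_vanish m n D U (fun i => b i ord0) (fun j => c j ord0)) => //.
- move=> j i; rewrite /D -natz natrX.
  apply: coprimezXr; rewrite /coprimez /U [2 * _]mulrC addrC.
  by rewrite gcdzC gcdzMDl.
- move=> i; apply: le_lt_trans (intvec_entry_le i bk) _.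
  by rewrite -[D%:Z]natz -natrX natz ltz_nat.
move=> j; rewrite -(ltr_int R) intr_norm rmorphD /= rmorph_sum /=.
set S := (X in `|X|).
have -> : S = D%:R ^+ (j.+1 * n) * (Om1 *m intvec R b + intvec R c) j ord0.
  rewrite /S [in RHS]mxE mulrDr [intvec R c _ _]mxE; congr (_ + _); last first.
    by rewrite rmorphM rmorphXn /= mulrC.
  rewrite mxE big_distrr /= big_mkcond /=; apply: eq_bigr => i _.
  rewrite [intvec R b _ _]mxE; case: ifPn => act.
    rewrite !rmorphM rmorphXn /= -UE// mulrA.
    have -> : (j.+1 * n = ex j i + i * m)%N by rewrite /ex subnK// ltnW.
    rewrite exprD; ring.
  rewrite !mxE (negPf act) pat 1?leqNgt//; ring.
have -> : (D%:Z ^+ (j * n))%:~R = D%:R ^+ (j.+1 * n) * (D%:R ^+ n)^-1 :> R.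
  by rewrite rmorphXn /= mulSn exprD mulrAC divff ?mul1r// gt_eqF.
rewrite normrM ger0_norm ?(ltW (D0R _))// ltr_pM2l//.
exact: le_lt_trans (normcV_le _ j) small.
Qed.

(** * Stages for at least two columns *)

Lemma exists_pow2_gt (R : realType) (x : R) : exists d, x < (2 ^ d)%:R.
Proof.
exists (Num.trunc x).+1; apply: lt_le_trans (truncnS_gt x) _.
by rewrite ler_nat ltnW// ltn_expl.
Qed.

Lemma critical_ratio_ge1 (R : realType) (m n q d : nat) (Om : 'M[R]_(m, n)) :
  (0 < m)%N -> (0 < n)%N -> (q < d)%N ->
  (forall j i, 2%:R ^+ q * Om j i \is a Num.int) ->
  (forall (j : 'I_m) (i : 'I_n), (j.+1 * n <= i * m)%N -> Om j i = 0) ->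
  1 <= dirichlet_ratio (Om + digit_mx R m n (2 ^ d)) ((2 ^ d) ^ m).-1.
Proof.
move=> m0 n0 qd dya pat; set B := ((2 ^ d) ^ m)%N.
have B1 : (1 < B)%N.
  rewrite /B -expnM; apply: leq_ltn_trans (ltn_expl (d * m) _) => //.
  by rewrite muln_gt0 m0 andbT (leq_trans _ qd).
have h : (0 < B.-1 < B)%N by lia.
have ps := critical_psi_ge n0 qd dya pat h.
rewrite /dirichlet_ratio prednK; last exact: ltnW.
apply: (@le_trans _ _ (B%:R ^+ n * ((2 ^ d)%:R ^+ n)^-1 ^+ m)).
  rewrite exprVn /B natrX -!exprM mulnC divff// expf_neq0//.
rewrite ler_wpM2l ?exprn_ge0//; apply: lerXn2r => //; last first.
  by rewrite nnegrE psi_ge0.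
by rewrite nnegrE invr_ge0 exprn_ge0.
Qed.

(** The invariant of the construction: dyadic entries, the zeros required by
    [critical_psi_ge], and an integral relation of height at most [T], which
    makes [psi Om] vanish from [T] on. *)
Definition dyadic_state (R : realType) (m n : nat) (Om : 'M[R]_(m, n))
    (T : nat) : Prop :=
  [/\ exists q, forall j i, 2%:R ^+ q * Om j i \is a Num.int,
      forall (j : 'I_m) (i : 'I_n), (j.+1 * n <= i * m)%N -> Om j i = 0
    & exists2 b, 1 <= `|intvec R b| <= T%:R &
        forall j, (Om *m intvec R b) j ord0 \is a Num.int].

(** For [x = 0] column [i0] of [Om] is left alone; for [x = 1] the whole of
    [digit_mx] is added. *)
Definition column_path (R : realType) (m n D : nat) (i0 : 'I_n)
    (Om : 'M[R]_(m, n)) (x : R) : 'M[R]_(m, n) :=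
  \matrix_(j, i) (Om j i + (if i == i0 then x else 1) * digit_mx R m n D j i).

Lemma column_path1 (R : realType) (m n D : nat) (i0 : 'I_n)
    (Om : 'M[R]_(m, n)) : column_path D i0 Om 1 = Om + digit_mx R m n D.
Proof. by apply/matrixP => j i; rewrite !mxE if_same mul1r. Qed.

Lemma column_path_dist (R : realType) (m n D : nat) (i0 : 'I_n)
    (Om : 'M[R]_(m, n)) (x : R) (j : 'I_m) (i : 'I_n) : (0 < D)%N -> 0 <= x <= 1 ->
  `|column_path D i0 Om x j i - Om j i| <= D%:R^-1.
Proof.
move=> D0 /andP[x0 x1]; rewrite mxE addrC addKr.
have /andP[e0 e1] := digit_mx_le R j i D0.
rewrite ger0_norm; case: ifP => _; rewrite ?mul1r ?mulr_ge0//.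
by apply: le_trans e1; rewrite ler_piMl.
Qed.

Lemma column_path_lip (R : realType) (m n D : nat) (i0 : 'I_n)
    (Om : 'M[R]_(m, n)) (x y : R) (j : 'I_m) (i : 'I_n) :
  (0 < D)%N ->
  `|column_path D i0 Om x j i - column_path D i0 Om y j i| <= `|x - y|.
Proof.
move=> D0; rewrite 2![column_path _ _ _ _ _ _]mxE opprD addrACA subrr add0r.
have /andP[e0 e1] := digit_mx_le R j i D0.
rewrite -mulrBl normrM; case: ifP => _; last first.
  by rewrite subrr normr0 mul0r.
rewrite ler_piMr// ger0_norm// (le_trans e1)// invf_le1 ?ler1n//.
by rewrite ltr0n.
Qed.

(** The relation at time [(2 ^ d) ^ m] is that multiple of the basis vector of
    the last column [il], whose entries have denominator [(2 ^ d) ^ m] and do not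
    move along the path. *)
Lemma column_path_state (R : realType) (m n q d K a : nat) (i0 il : 'I_n)
    (Om : 'M[R]_(m, n)) :
  i0 != il -> il.+1 = n -> (q < d)%N -> (0 < m)%N ->
  (forall j i, 2%:R ^+ q * Om j i \is a Num.int) ->
  (forall (j : 'I_m) (i : 'I_n), (j.+1 * n <= i * m)%N -> Om j i = 0) ->
  dyadic_state (column_path (2 ^ d) i0 Om (a%:R / 2%:R ^+ K)) ((2 ^ d) ^ m).
Proof.
move=> i0il ilE qd m0 dya pat.
have p2 p : 2%:R ^+ p != 0 :> R by rewrite expf_neq0// pnatr_eq0.
have int2 p : 2%:R ^+ p \is a @Num.int R by rewrite rpredX// rpred_nat.
have digint p (j : 'I_m) (i : 'I_n) : (d * (j.+1 * n - i * m) <= p)%N ->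
    2%:R ^+ p * digit_mx R m n (2 ^ d) j i \is a Num.int.
  move=> le; rewrite mxE; case: ifP => _; last by rewrite mulr0 rpred0.
  rewrite natrX -exprM -(subnK le) exprD -mulrA divff// mulr1.
  exact: int2.
split.
- exists (q + K + d * (m * n))%N => j i; rewrite mxE mulrDr; apply: rpredD.
    rewrite -addnA addnC exprD -mulrA; apply: rpredM => //.
  have -> : 2%:R ^+ (q + K + d * (m * n)) *
     ((if i == i0 then a%:R / 2%:R ^+ K else 1) * digit_mx R m n (2 ^ d) j i) =
     2%:R ^+ q * (if i == i0 then a%:R else 2%:R ^+ K) *
     (2%:R ^+ (d * (m * n)) * digit_mx R m n (2 ^ d) j i).
    rewrite !exprD; case: ifP => _; last by ring.
    by field; exact: p2.
  apply: rpredM; first by case: ifP => _; rewrite rpredM// rpred_nat.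
  apply: digint; rewrite leq_mul2l; apply/orP; right.
  by apply: leq_trans (leq_subr _ _) _; rewrite leq_mul2r ltn_ord orbT.
- move=> j i act; rewrite mxE pat// add0r mxE ltnNge act /= mulr0 //.
exists (axis_vec il ((2 ^ d) ^ m)).
  by apply: axis_vec_norm; rewrite ?expn_gt0.
move=> j; rewrite mulmx_axis_vec mxE eq_sym (negPf i0il) mul1r mulrC.
rewrite -expnM natrX mulrDr; apply: rpredD.
  have dm : (q <= d * m)%N by nia.
  by rewrite -(subnK dm) exprD -mulrA rpredM.
apply: digint; rewrite leq_mul2l; apply/orP; right.
rewrite -{1}ilE leq_subLR; have := ltn_ord j; move: ilE; nia.
Qed.

(** A discrete substitute for the intermediate value theorem. *)
Lemma first_crossing (P : nat -> nat -> Prop) (N : nat) :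
  (exists k, P N k) ->
  exists a, [/\ (a <= N)%N, exists k, P a k &
    a = 0%N \/ exists2 a', a = a'.+1 & ~ exists k, P a' k].
Proof.
move=> PN; pose Q a := `[< exists k, P a k >].
have [|a /asboolP Pa amin] := @ex_minnP Q; first by exists N; exact/asboolP.
exists a; split => //; first by apply: amin; exact/asboolP.
case: a Pa amin => [|a'] Pa amin; [by left | right; exists a' => // Pa'].
by have := amin a'; rewrite ltnn => /(_ (asboolT Pa')).
Qed.

(** Along the path of column [i0] the maximum of the ratio over [T <= k < T'] is
    nearly zero at the start and at least 1 at the end.  It moves by at most [e]
    in one step, so at the first step where it reaches [L - e] it is at most
    [L]. *)
Lemma dyadic_stage (R : realType) (m n : nat) (L : R) (Om : 'M[R]_(m, n))
    (T : nat) (e : R) :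
  (0 < m)%N -> (1 < n)%N -> 0 <= L <= 1 -> (0 < T)%N ->
  dyadic_state Om T -> 0 < e -> exists Om' T',
  [/\ dyadic_state Om' T', (T < T')%N,
      forall j i, `|Om' j i - Om j i| <= e,
      forall k, (T <= k < T')%N -> dirichlet_ratio Om' k <= L + e
    & exists2 k, (T <= k < T')%N & L - e <= dirichlet_ratio Om' k].
Proof.
move=> m0 n1 /andP[L0 L1] T0 [[q dya] pat [b bT Omb]] e0.
have n0 : (0 < n)%N by exact: ltnW.
have n1n : (n.-1 < n)%N by rewrite prednK.
pose i0 := Ordinal n0; pose il := Ordinal n1n.
have i0il : i0 != il by rewrite -val_eqE /=; lia.
have ilE : il.+1 = n by rewrite /= prednK.
have [d] := @exists_pow2_gt R
  (Num.max (Num.max T%:R (2 ^ q)%:R)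
           (Num.max (e^-1) ((lip_const m n (2 ^ q))%:R / e))).
rewrite !gt_max => /andP[/andP[dT dq] /andP[de dl]].
rewrite !ltr_nat in dT dq; rewrite ltn_exp2l// in dq.
set D := (2 ^ d)%N in dT de dl.
have D0 : (0 < D)%N by rewrite expn_gt0.
have DR0 : 0 < D%:R :> R by rewrite ltr0n.
have De : D%:R^-1 <= e by rewrite -[leRHS]invrK lef_pV2 ?posrE ?invr_gt0// ltW.
pose B := (D ^ m)%N.
have TB : (T < B)%N.
  by apply: leq_trans dT _; rewrite -[X in (X <= _)%N]expn1 leq_pexp2l.
have [K] := @exists_pow2_gt R ((lip_const m n B)%:R / e) => HK.
have K0 : 0 < 2%:R ^+ K :> R by rewrite exprn_gt0.
have lipK : (lip_const m n B)%:R * (2%:R ^+ K)^-1 <= e.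
  by rewrite ler_pdivrMr// mulrC -ler_pdivrMr// -natrX ltW.
pose path a := column_path D i0 Om (a%:R / 2%:R ^+ K).
have a01 a : (a <= 2 ^ K)%N -> 0 <= (a%:R / 2%:R ^+ K : R) <= 1.
  by move=> aK; rewrite divr_ge0//= ler_pdivrMr// mul1r -natrX ler_nat.
(* before [2 ^ q] the old relation is nearly kept, after that the first column
   still has denominator [2 ^ q] *)
have start k : (T <= k < B)%N -> dirichlet_ratio (path 0%N) k <= e.
  move=> /andP[Tk kB]; have [kq|qk] := ltnP k (2 ^ q).
    have k0 : (0 < k <= 2 ^ q)%N by rewrite (ltnW kq) andbT (leq_trans T0).
    have dist j i : `|path 0%N j i - Om j i| <= D%:R^-1.
      by apply: column_path_dist => //; apply: a01.
    have Di0 : 0 <= D%:R^-1 :> R by rewrite invr_ge0 ltW.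
    apply: le_trans (dirichlet_ratio_lip n0 k0 Di0 dist) _.
    have bk : 1 <= `|intvec R b| <= k%:R.
      have /andP[b1 b2] := bT; rewrite b1 (le_trans b2)// ler_nat//.
    rewrite (dirichlet_ratio_eq0 m0 bk Omb) add0r.
    by rewrite ler_pdivrMr// mulrC -ler_pdivrMr// ltW.
  have bk : 1 <= `|intvec R (axis_vec i0 (2 ^ q))| <= k%:R.
    by apply: axis_vec_norm; rewrite ?expn_gt0// ler_nat.
  rewrite (dirichlet_ratio_eq0 m0 bk) ?ltW// => j.
  by rewrite mulmx_axis_vec mxE eqxx !mul0r addr0 mulrC natrX dya.
pose P a k := (T <= k < B)%N /\ L - e <= dirichlet_ratio (path a) k.
have PN : exists k, P (2 ^ K)%N k.
  have B0 : (0 < B)%N by apply: leq_ltn_trans TB.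
  exists B.-1; split; first by rewrite -ltnS prednK// TB /=.
  rewrite /path natrX divff ?gt_eqF// column_path1.
  apply: le_trans (critical_ratio_ge1 m0 n0 dq dya pat).
  by rewrite lerBlDr (le_trans L1)// lerDl ltW.
have [a [aN [k [kTB kL]] aprev]] := first_crossing PN.
exists (path a), B; split => //.
- exact: (column_path_state K a i0il ilE dq m0 dya pat).
- by move=> j i; apply: le_trans (column_path_dist _ _ _ _ D0 (a01 a aN)) De.
- move=> k' k'TB; case: aprev => [a0|[a' aE notP]].
    by rewrite a0 (le_trans (start k' k'TB))// lerDr.
  have low : dirichlet_ratio (path a') k' < L - e.
    by rewrite ltNge; apply/negP => h; apply: notP; exists k'.
  have k0 : (0 < k' <= B)%N.
    by have /andP[Tk' /ltnW->] := k'TB; rewrite (leq_trans T0 Tk').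
  have i2 : 0 <= (2%:R ^+ K)^-1 :> R by rewrite invr_ge0 ltW.
  have dist j i : `|path a j i - path a' j i| <= (2%:R ^+ K)^-1.
    apply: le_trans (column_path_lip _ _ _ _ _ _ D0) _.
    by rewrite -mulrBl aE -natr1 addrC addKr mul1r ger0_norm.
  have := dirichlet_ratio_lip n0 k0 i2 dist.
  by move: lipK low; lra.
by exists k.
Qed.

(** * Stages for one column *)

(** The rows are indexed by ['I_p.+1] so that [p] is the exponent [m - 1]. *)
Definition simultaneous_shift (R : realType) (p N c : nat) (xi : 'M[R]_(p.+1, 1))
    : 'M[R]_(p.+1, 1) :=
  \matrix_(j, i) (xi j i + (if (j < p)%N then (N%:R ^+ j.+1)^-1
                            else ((c * N ^ p)%:R)^-1)).

Section SimultaneousStage.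
Variables (R : realType) (p T e N c : nat) (xi : 'M[R]_(p.+1, 1)).
Hypotheses (p0 : (0 < p)%N) (T1 : (1 < T)%N) (e2 : (1 < e)%N).
Hypothesis xiT : forall j, T%:R * xi j ord0 \is a Num.int.
Hypotheses (NE : N = (T ^ e)%N) (Nc : (N <= c)%N).
Let xi' := simultaneous_shift N c xi.

Let T0 : (0 < T)%N. Proof. exact: ltnW. Qed.
Let N0 : (0 < N)%N. Proof. by rewrite NE expn_gt0 T0. Qed.
Let Nn0 a : (0 < N ^ a)%N. Proof. by rewrite expn_gt0 N0. Qed.
Let NXR a : (N ^ a)%:R = N%:R ^+ a :> R. Proof. exact: natrX. Qed.
Let c0 : (0 < c)%N. Proof. exact: leq_trans Nc. Qed.
Let cNp0 : (0 < c * N ^ p)%N. Proof. by rewrite muln_gt0 c0 Nn0. Qed.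
Let TN : (T * T <= N)%N.
Proof. by rewrite mulnn NE leq_exp2l. Qed.
Let NR0 : 0 < N%:R :> R. Proof. by rewrite ltr0n. Qed.
Let cR0 : 0 < c%:R :> R. Proof. by rewrite ltr0n. Qed.
Let NX0 a : 0 < N%:R ^+ a :> R. Proof. by rewrite exprn_gt0. Qed.

Let natint (a : nat) : a%:R \is a @Num.int R. Proof. exact: rpred_nat. Qed.

Let dvdTX a : (0 < a)%N -> (T * T %| N ^ a)%N.
Proof.
by move=> a0; rewrite NE -expnM mulnn dvdn_exp2l//; case: (a) a0 => // a' _; nia.
Qed.

Let xi_mult a j : (T %| a)%N -> a%:R * xi j ord0 \is a Num.int.
Proof. by move=> /dvdnP[a' ->]; rewrite natrM -mulrA rpredM. Qed.

Let dvdT a : (0 < a)%N -> (T %| N ^ a)%N.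
Proof. by move=> a0; apply: dvdn_trans (dvdTX a0); rewrite dvdn_mulr. Qed.

Let shiftE Q j : (xi' *m intvec R (axis_vec ord0 Q)) j ord0 =
  Q%:R * xi j ord0 + Q%:R * (if (j < p)%N then (N%:R ^+ j.+1)^-1
                            else ((c * N ^ p)%:R)^-1).
Proof. by rewrite mulmx_axis_vec mxE mulrDl !(mulrC Q%:R). Qed.

Lemma simultaneous_shift_dist j i : `|xi' j i - xi j i| <= N%:R^-1.
Proof.
rewrite mxE addrC addKr; case: ifP => _; rewrite ger0_norm ?invr_ge0 ?exprn_ge0//.
  rewrite lef_pV2 ?posrE// -NXR ler_nat.
  by rewrite -[X in (X <= _)%N]expn1 leq_pexp2l.
rewrite lef_pV2 ?posrE ?ltr0n// ?cNp0//.
by rewrite ler_nat (leq_trans Nc)// leq_pmulr// Nn0.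
Qed.

Lemma simultaneous_shift_int j : (c * N ^ p)%:R * xi' j ord0 \is a Num.int.
Proof.
rewrite mxE mulrDr; apply: rpredD.
  by apply: xi_mult; rewrite dvdn_mull// dvdT.
case: ifPn => [jp|_]; last first.
  by rewrite divff ?rpred1// pnatr_eq0 -lt0n cNp0.
have -> : (c * N ^ p = c * N ^ (p - j.+1) * N ^ j.+1)%N.
  by rewrite -mulnA -expnD subnK.
by rewrite natrM NXR mulfK ?gt_eqF.
Qed.

(** Between [T] and [N] the old denominator [T] is a good approximation. *)
Lemma simultaneous_upper_first k : (T <= k < N)%N ->
  dirichlet_ratio xi' k <= (T * T)%:R / N%:R.
Proof.
move=> /andP[Tk kN].
have TleN : T%:R / N%:R <= 1 :> R.
  by rewrite ler_pdivrMr// mul1r ler_nat (leq_trans _ TN)// leq_pmulr.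
have TN0 : 0 <= T%:R / N%:R :> R by rewrite divr_ge0.
have bk : 1 <= `|intvec R (axis_vec (ord0 : 'I_1) T)| <= k%:R.
  by apply: axis_vec_norm; rewrite // ler_nat.
have ps : psi xi' k%:R <= T%:R / N%:R.
  apply: psi_le_near bk _ => // j; exists (T%:R * xi j ord0) => //.
  rewrite mulmx_axis_vec mulrC -mulrBr normrM ger0_norm// ler_wpM2l//.
  exact: simultaneous_shift_dist.
rewrite /dirichlet_ratio expr1.
apply: (@le_trans _ _ (N%:R * (T%:R / N%:R) ^+ 2)).
  apply: ler_pM; rewrite ?exprn_ge0 ?psi_ge0 ?ler_nat//.
  apply: le_trans (_ : (T%:R / N%:R) ^+ p.+1 <= _).
    by apply: lerXn2r; rewrite ?nnegrE ?psi_ge0.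
  by rewrite ler_wiXn2l.
by rewrite natrM le_eqVlt; apply/orP; left; apply/eqP; field; rewrite gt_eqF.
Qed.

(** Between [N] and [N ^ p] the approximation [N] leaves an error at most
    [1 / N], much less than the critical size. *)
Lemma simultaneous_upper_second k : (N <= k < N ^ p)%N ->
  dirichlet_ratio xi' k <= N%:R^-1.
Proof.
move=> /andP[Nk kN].
have bk : 1 <= `|intvec R (axis_vec (ord0 : 'I_1) N)| <= k%:R.
  by apply: axis_vec_norm; rewrite // ler_nat.
have ps : psi xi' k%:R <= N%:R^-1.
  apply: psi_le_near bk _ => // j.
  have Nxi : N%:R * xi j ord0 \is a Num.int.
    by apply: xi_mult; rewrite -[N]expn1 dvdT.
  rewrite shiftE; case: ifPn => [jp|_].
    rewrite exprS invfM mulrA divff ?gt_eqF// mul1r.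
    have [->|j0] := eqVneq (j : nat) 0%N.
      exists (N%:R * xi j ord0 + 1); first by rewrite rpredD// rpred1.
      by rewrite expr0 invr1 subrr normr0.
    exists (N%:R * xi j ord0) => //.
    rewrite addrC addKr ger0_norm ?invr_ge0 ?exprn_ge0//.
    rewrite lef_pV2 ?posrE// -NXR ler_nat.
    by rewrite -[X in (X <= _)%N]expn1 leq_pexp2l// lt0n.
  exists (N%:R * xi j ord0) => //; rewrite addrC addKr ger0_norm; last first.
    by rewrite mulr_ge0 ?invr_ge0.
  rewrite natrM ler_pdivrMr; last by rewrite mulr_gt0// NXR.
  rewrite -ler_pdivrMl ?invr_gt0// invrK -natrM -natrM ler_nat leq_mul//.
  by rewrite -[X in (X <= _)%N]expn1 leq_pexp2l.
rewrite /dirichlet_ratio expr1.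
apply: (@le_trans _ _ (N%:R ^+ p * (N%:R^-1) ^+ p.+1)).
  apply: ler_pM; rewrite ?exprn_ge0 ?psi_ge0//.
    by rewrite -NXR ler_nat.
  by apply: lerXn2r; rewrite ?nnegrE ?psi_ge0.
by rewrite exprS mulrCA exprVn divff ?mulr1// gt_eqF.
Qed.

(** From [N ^ p] on, the approximation [N ^ p] is exact in all rows but the last,
    where it leaves the error [1 / c]. *)
Lemma simultaneous_upper_third k : (N ^ p <= k < c * N ^ p)%N ->
  dirichlet_ratio xi' k <= (N%:R / c%:R) ^+ p.
Proof.
move=> /andP[Nk kN].
have bk : 1 <= `|intvec R (axis_vec (ord0 : 'I_1) (N ^ p))| <= k%:R.
  by apply: axis_vec_norm; rewrite ?Nn0// ler_nat.
have ci : 0 <= c%:R^-1 :> R by rewrite invr_ge0.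
have ps : psi xi' k%:R <= c%:R^-1.
  apply: psi_le_near bk _ => // j.
  have Nxi : (N ^ p)%:R * xi j ord0 \is a Num.int by apply: xi_mult; exact: dvdT.
  rewrite shiftE; case: ifPn => [jp|_].
    exists ((N ^ p)%:R * xi j ord0 + (N ^ p)%:R / N%:R ^+ j.+1).
      rewrite rpredD//.
      have -> : (N ^ p = N ^ (p - j.+1) * N ^ j.+1)%N by rewrite -expnD subnK.
      by rewrite natrM (NXR j.+1) mulfK ?gt_eqF.
    by rewrite subrr normr0.
  exists ((N ^ p)%:R * xi j ord0) => //; rewrite addrC addKr natrM invfM.
  by rewrite mulrCA divff ?mulr1 ?ger0_norm// NXR gt_eqF.
rewrite /dirichlet_ratio expr1.
apply: (@le_trans _ _ ((c%:R * N%:R ^+ p) * (c%:R^-1) ^+ p.+1)).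
  apply: ler_pM; rewrite ?exprn_ge0 ?psi_ge0//.
    by rewrite -NXR -natrM ler_nat.
  by apply: lerXn2r; rewrite ?nnegrE ?psi_ge0.
by rewrite exprS exprMn mulrACA divff ?mul1r// gt_eqF.
Qed.

(** An integer [Q] with error below [1 / c <= 1 / N] in the first [p] rows is a
    multiple of [N ^ p], as those rows read its digits in base [N].  If
    [Q = l * N ^ p], the error in the last row is the distance from [l / c] to
    the integers, so [c] divides [l], and [Q = 0] below [c * N ^ p]. *)
Lemma simultaneous_lower k : (0 < k < c * N ^ p)%N -> c%:R^-1 <= psi xi' k%:R.
Proof.
move=> /andP[k0 kT]; apply: psi_ge => //; first by rewrite ler1n.
move=> b z /andP[b1 bk]; rewrite leNgt; apply/negP => small.
have [i] := intvec_neq0 b1; rewrite (ord1 i) => {i}; set Q := b ord0 ord0.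
apply/negP; rewrite negbK; apply/eqP.
have row j : `|xi' j ord0 * Q%:~R + (z j ord0)%:~R| < c%:R^-1.
  apply: le_lt_trans small; apply: le_trans (normcV_le _ j).
  have -> : (xi' *m intvec R b + intvec R z) j ord0 =
      xi' j ord0 * Q%:~R + (z j ord0)%:~R; last exact: lexx.
  rewrite [LHS]mxE [X in X + _ = _]mxE big_ord1.
  by rewrite [intvec R b _ _]mxE [intvec R z _ _]mxE.
have Nz a : N%:Z ^+ a = (N ^ a)%:Z by rewrite -[N%:Z]natz -natrX natz.
have digits a : (a <= p)%N -> (N%:Z ^+ a %| Q)%Z.
  elim: a => [|a IH] ap; first by rewrite expr0 dvd1z.
  have {}IH := IH (ltnW ap).
  have ap1 : (a < p.+1)%N by apply: leq_trans ap _.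
  pose j := Ordinal ap1.
  have /dvdnP[w wE] := dvdTX (ltn0Sn a).
  pose u := Num.floor (T%:R * xi j ord0); pose U := 1 + w%:Z * T%:Z * u.
  have UE : N%:R ^+ a.+1 * xi' j ord0 = U%:~R.
    rewrite mxE ap mulrDr divff ?gt_eqF// addrC /U rmorphD /= !rmorphM /=.
    rewrite floorK// -NXR wE !natrM -!pmulrn; ring.
  (* [N] is a power of [T], and [U] is 1 modulo [T] as [T ^ 2] divides [N] *)
  have coU : coprimez (N%:Z ^+ a.+1) U.
    apply: coprimezXl; rewrite NE -natz natrX natz; apply: coprimezXl.
    have -> : U = w%:Z * u * T%:Z + 1 by rewrite /U; ring.
    by rewrite /coprimez gcdzMDl gcdz1.
  rewrite -(Gauss_dvdzr _ coU).
  have V0 : U * Q + z j ord0 * N%:Z ^+ a.+1 = 0.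
    apply: (@dvdz_small0 (N%:Z ^+ a)).
      by apply: rpredD; apply: dvdz_mull => //; rewrite dvdz_exp2l.
    rewrite -(ltr_int R) intr_norm rmorphD !rmorphM /= -UE !rmorphXn /= -!pmulrn.
    have -> : N%:R ^+ a.+1 * xi' j ord0 * Q%:~R + (z j ord0)%:~R * N%:R ^+ a.+1 =
       N%:R ^+ a.+1 * (xi' j ord0 * Q%:~R + (z j ord0)%:~R) by ring.
    rewrite normrM ger0_norm ?(ltW (NX0 _))//.
    apply: lt_le_trans (_ : N%:R ^+ a.+1 * c%:R^-1 <= _).
      by rewrite ltr_pM2l.
    rewrite ler_pdivrMr// exprS mulrC ler_wpM2l ?(ltW (NX0 _))//.
    by rewrite ler_nat.
  by move/eqP: V0; rewrite addr_eq0 => /eqP ->; rewrite rpredN dvdz_mull.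
have /dvdzP[l lE] := digits p (leqnn p).
have [l0|l0] := eqVneq l 0; first by rewrite lE l0 mul0r.
exfalso.
pose j : 'I_p.+1 := ord_max.
have Nxi : (N ^ p)%:R * xi j ord0 \is a Num.int by apply: xi_mult; exact: dvdT.
pose u := Num.floor ((N ^ p)%:R * xi j ord0).
have V0 : l * (c%:Z * u + 1) + z j ord0 * c%:Z = 0.
  apply: (@dvdz_small0 1); first by rewrite dvd1z.
  rewrite -(ltr_int R) intr_norm !(rmorphD, rmorphM) /= floorK//.
  have xiE : xi' j ord0 = xi j ord0 + (c%:R * N%:R ^+ p)^-1.
    by rewrite mxE ltnn natrM NXR.
  have QE : Q%:~R = l%:~R * N%:R ^+ p :> R.
    by rewrite lE rmorphM rmorphXn.
  have := row j; rewrite xiE QE => rj.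
  have : c%:R * `|(xi j ord0 + (c%:R * N%:R ^+ p)^-1) * (l%:~R * N%:R ^+ p) +
      (z j ord0)%:~R| < 1 :> R.
    by rewrite mulrC -ltr_pdivlMr// div1r.
  rewrite -[X in X * `|_|]ger0_norm// -normrM.
  set lhs := (X in `|X|); set rhs := (X in _ -> `|X| < _).
  suff -> : lhs = rhs by [].
  rewrite /lhs /rhs -!pmulrn NXR; field.
  by rewrite !gt_eqF.
have cl : (c%:Z %| l)%Z.
  apply/dvdzP; exists (- (l * u + z j ord0)).
  by apply/eqP; rewrite -subr_eq0 -[X in _ == X]V0; apply/eqP; ring.
have := intvec_entry_le ord0 bk; rewrite -/Q lE normrM => Qk.
have : `|l| < c%:Z.
  have Np0 : 0 < N%:Z ^+ p by rewrite exprn_gt0.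
  rewrite -(ltr_pM2r Np0) -[X in _ * X < _]ger0_norm ?(ltW Np0)//.
  apply: le_lt_trans Qk _; rewrite Nz -PoszM ltz_nat //.
by move=> /(dvdz_small0 cl) /eqP; rewrite (negPf l0).
Qed.

End SimultaneousStage.

Definition simultaneous_state (R : realType) (p : nat) (xi : 'M[R]_(p.+1, 1))
    (T : nat) : Prop :=
  (1 < T)%N /\ forall j, T%:R * xi j ord0 \is a Num.int.

(** The value [(N / c) ^ p] is attained at the end of the stage.  It is at most
    [L] by the choice of [c], and close to [L] since [c] is the least possible
    and is at least [N]. *)
Lemma simultaneous_stage (R : realType) (p : nat) (L : R)
    (xi : 'M[R]_(p.+1, 1)) (T : nat) (e : R) :
  (0 < p)%N -> 0 < L <= 1 -> simultaneous_state xi T -> 0 < e ->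
  exists xi' T',
  [/\ simultaneous_state xi' T', (T < T')%N,
      forall j i, `|xi' j i - xi j i| <= e,
      forall k, (T <= k < T')%N -> dirichlet_ratio xi' k <= L + e
    & exists2 k, (T <= k < T')%N & L - e <= dirichlet_ratio xi' k].
Proof.
move=> p0 /andP[L0 L1] [T1 xiT] e0.
have T0 : (0 < T)%N by exact: ltnW.
have [d] := @exists_pow2_gt R
  (Num.max e^-1 (Num.max ((T * T)%:R / e) (p%:R / e))).
rewrite !gt_max => /andP[de /andP[dT dp]].
pose N := (T ^ d.+2)%N.
have dN : (2 ^ d)%:R <= N%:R :> R.
  rewrite ler_nat; apply: (@leq_trans (T ^ d)).
    2: by rewrite leq_exp2l// -addn2 leq_addr.
  by case: (d) => // d'; rewrite leq_exp2r.
have NE : N = (T ^ d.+2)%N by [].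
have N0 : (0 < N)%N by rewrite expn_gt0 T0.
have NR0 : 0 < N%:R :> R by rewrite ltr0n.
have small x : x / e < (2 ^ d)%:R -> x / N%:R <= e.
  move=> xd; rewrite ler_pdivrMr// mulrC -ler_pdivrMr//.
  exact: le_trans (ltW xd) dN.
have small1 : N%:R^-1 <= e by rewrite -div1r small// div1r.
clearbody N.
have [Q Qex] : exists c, N%:R ^+ p <= L * c%:R ^+ p.
  exists (N * (Num.trunc L^-1).+1)%N; rewrite natrM exprMn mulrCA ler_peMr//.
  set x := _.+1%:R.
  have Lx : 1 <= L * x.
    rewrite -ler_pdivrMl// mulr1 ltW// truncnS_gt//.
  apply: le_trans Lx _; rewrite ler_wpM2l ?(ltW L0)//.
  by rewrite -[leLHS]expr1 ler_weXn2l// ler1n.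
have [c cP cmin] := ex_minnP (ex_intro (fun c => N%:R ^+ p <= L * c%:R ^+ p) Q Qex).
have Nc : (N <= c)%N.
  rewrite leqNgt; apply/negP => cN; move: cP; apply/negP; rewrite -ltNge.
  apply: (@le_lt_trans _ _ (c%:R ^+ p)); first by rewrite ler_piMl// exprn_ge0.
  by rewrite ltrXn2r ?ltr_nat// -lt0n.
have c0 : (0 < c)%N by exact: leq_trans Nc.
have cR0 : 0 < c%:R :> R by rewrite ltr0n.
have cNp : (N <= c * N ^ p)%N.
  by apply: leq_trans Nc _; rewrite leq_pmulr// expn_gt0 N0.
have TN : (T < N)%N by rewrite NE -[X in (X < _)%N]expn1 ltn_exp2l.
have TT' : (T < c * N ^ p)%N by exact: leq_trans cNp.
have e2 : (1 < d.+2)%N by [].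
have up : (N%:R / c%:R) ^+ p <= L.
  by rewrite expr_div_n ler_pdivrMr// exprn_gt0.
exists (simultaneous_shift N c xi), (c * N ^ p)%N; split.
- split; first exact: leq_ltn_trans TT'.
  exact: (simultaneous_shift_int p0 T1 e2 xiT NE Nc).
- by [].
- move=> j i; apply: le_trans (simultaneous_shift_dist xi T1 NE Nc j i) _.
  exact: small1.
- move=> k /andP[Tk kT'].
  have [kN|Nk] := ltnP k N.
    have kI : (T <= k < N)%N by rewrite Tk kN.
    apply: le_trans (simultaneous_upper_first p0 T1 e2 xiT NE Nc kI) _.
    by apply: ler_wpDl; [exact: ltW | exact: small].
  have [kN|Npk] := ltnP k (N ^ p).
    have kI : (N <= k < N ^ p)%N by rewrite Nk kN.
    apply: le_trans (simultaneous_upper_second p0 T1 e2 xiT NE Nc kI) _.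
    by apply: ler_wpDl; [exact: ltW | exact: small1].
  have kI : (N ^ p <= k < c * N ^ p)%N by rewrite Npk kT'.
  apply: le_trans (simultaneous_upper_third p0 T1 e2 xiT NE Nc kI) _.
  by rewrite (le_trans up)// lerDl ltW.
have T'0 : (0 < c * N ^ p)%N by exact: leq_trans cNp.
exists (c * N ^ p).-1; first by rewrite -ltnS prednK// TT' /=.
have kI : (0 < (c * N ^ p).-1 < c * N ^ p)%N.
  rewrite prednK// leqnn andbT -ltnS prednK//.
  exact: leq_ltn_trans TT'.
have low := simultaneous_lower p0 T1 e2 xiT NE Nc kI.
rewrite /dirichlet_ratio prednK// expr1.
apply: (@le_trans _ _ ((c * N ^ p)%:R * c%:R^-1 ^+ p.+1)); last first.
  by rewrite ler_wpM2l//; apply: lerXn2r; rewrite ?nnegrE ?psi_ge0 ?invr_ge0.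
have -> : (c * N ^ p)%:R * c%:R^-1 ^+ p.+1 = N%:R ^+ p / c%:R ^+ p :> R.
  by rewrite exprS natrM natrX mulrACA divff ?mul1r ?exprVn// gt_eqF.
(* minimality of [c]: its predecessor is too small *)
have cpred : L * c.-1%:R ^+ p < N%:R ^+ p.
  rewrite ltNge; apply/negP => /cmin; rewrite leqNgt => /negP; apply.
  by rewrite prednK.
have := expr_succ_ratio_ge R p c.-1; rewrite prednK// => h.
have pc : p%:R / c%:R <= e.
  apply: le_trans (small _ dp); rewrite ler_wpM2l// lef_pV2 ?posrE//.
  by rewrite ler_nat.
rewrite ler_pdivlMr ?exprn_gt0//; apply: le_trans (ltW cpred).
apply: le_trans (_ : L * (c%:R ^+ p * (1 - p%:R / c%:R)) <= _); last first.
  by rewrite ler_wpM2l// ltW.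
rewrite mulrCA mulrC ler_wpM2l ?exprn_ge0//.
have pc0 : 0 <= p%:R / c%:R :> R by rewrite divr_ge0.
have : L * (p%:R / c%:R) <= p%:R / c%:R by rewrite ler_piMl.
move: pc pc0; move: (p%:R / c%:R) => x; lra.
Qed.

(** * The Dirichlet spectrum *)

Lemma exists_Theta (R : realType) (m n : nat) (lam : R) :
  (0 < m)%N -> (0 < n)%N -> (m, n) <> (1, 1)%N -> 0 <= lam <= 1 ->
  exists Om : 'M[R]_(m, n), Theta Om = lam%:E.
Proof.
move=> m0 n0 mn1 /andP[lam0 lam1].
suff [Om [up low]] : exists Om : 'M[R]_(m, n),
    (forall e, 0 < e -> exists K, forall k, (K <= k)%N ->
       dirichlet_ratio Om k <= lam ^+ m + e) /\
    (forall e K, 0 < e -> exists2 k, (K <= k)%N &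
       lam ^+ m - e <= dirichlet_ratio Om k).
  exists Om; apply/eqP; rewrite eq_le; apply/andP; split.
    exact: Theta_le.
  exact: Theta_ge.
have L1 : lam ^+ m <= 1 by rewrite exprn_ile1.
have [n1|n2] := leqP n 1.
  have nE : n = 1%N by apply/eqP; rewrite eqn_leq n1.
  case: m m0 mn1 L1 => // p _; rewrite {n n0 n1}nE => p1 L1.
  have p0 : (0 < p)%N by case: (p) p1.
  have [l0|l0] := eqVneq lam 0.
    exists 0; rewrite l0 expr0n /=.
    have r0 k : (0 < k)%N -> dirichlet_ratio (0 : 'M[R]_(p.+1, 1)) k = 0.
      move=> k0; have bk : 1 <= `|intvec R (axis_vec (ord0 : 'I_1) 1)| <= k%:R.
        by apply: axis_vec_norm; rewrite // ler1n.
      by apply: (dirichlet_ratio_eq0 _ bk) => // j; rewrite mul0mx mxE.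
    split=> [e e0|e K e0].
      by exists 1%N => k k0; rewrite r0// add0r ltW.
    by exists K.+1 => //; rewrite r0// sub0r oppr_le0 ltW.
  apply: (exists_limit_of_stages (St := @simultaneous_state R p)) => //.
    exists 0, 2%N; split => //; split => // j.
    by rewrite mxE mulr0 rpred0.
  move=> xi T e _ St e0; apply: simultaneous_stage => //.
  by rewrite L1 andbT exprn_gt0// lt0r l0.
apply: (exists_limit_of_stages (St := @dyadic_state R m n)) => //.
  exists 0, 1%N; split => //; split.
  - by exists 0%N => j i; rewrite mxE mulr0 rpred0.
  - by move=> j i _; rewrite mxE.
  exists (axis_vec (Ordinal n0) 1); first by apply: axis_vec_norm.
  by move=> j; rewrite mul0mx mxE rpred0.
move=> Om T e T0 St e0; apply: dyadic_stage => //.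
by rewrite L1 exprn_ge0.
Qed.

Lemma Dirichlet_spectrum_full (R : realType) (m n : nat) :
  (0 < m)%N -> (0 < n)%N -> (m, n) <> (1, 1)%N ->
  Dirichlet_spectrum R m n = [set x%:E | x in `[0, 1]].
Proof.
move=> m0 n0 mn1; apply/seteqP; split => [_ [Om _ <-]|_ [x /= x01 <-]].
  have t0 : (0%:E <= Theta Om)%E.
    apply: Theta_ge => // e K e0; exists K => //.
    rewrite expr0n (gtn_eqF m0) sub0r; apply: (@le_trans _ _ 0).
      by rewrite oppr_le0 ltW.
    by rewrite /dirichlet_ratio mulr_ge0 ?exprn_ge0 ?psi_ge0.
  have t1 := Theta_le1 Om m0 n0.
  have fin : Theta Om \is a fin_num.
    by rewrite fin_numE; case: (Theta Om) t0 t1.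
  exists (fine (Theta Om)); last by rewrite fineK.
  by rewrite /= in_itv /= -!lee_fin fineK// t0 t1.
move: x01; rewrite in_itv /= => x01.
by have [Om OmE] := exists_Theta m0 n0 mn1 x01; exists Om.
Qed.

Unset Implicit Arguments.

Theorem theorem3p2 (R : realType) (k m n : nat)
    (hk : (0 < k)%N) (hm : (0 < m)%N) (hn : (0 < n)%N) :
  ((m%:R / n%:R : R) \in `]0, 1 / 2] \/ (m%:R / n%:R : R) \in `]1, +oo[ ->
   ~ (exists j : nat, (m, n) = (2 * j + 3, 2)%N) ->
   exists2 c : R, 0 < c &
     [set x%:E | x in `[0, c]] `<=` Dirichlet_spectrum R m n)
  /\
  ((m %| n)%N \/ (n %| m)%N -> (m, n) <> (1, 1)%N ->
   Dirichlet_spectrum R m n = [set x%:E | x in `[0, 1]])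
  /\
  Dirichlet_spectrum R m n `<=` Dirichlet_spectrum R (k * m) (k * n).
Proof.
split; [|split].
- move=> ratio _; exists 1 => //; rewrite Dirichlet_spectrum_full// => -[m1 n1].
  move: ratio; rewrite m1 n1 divr1 !in_itv /= => -[] /andP[]; lra.
- by move=> _ mn1; apply: Dirichlet_spectrum_full.
exact: Dirichlet_spectrum_scale.
Qed.
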